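(* Let $n\ge 2$ be a prime power, and let $GK$ be the Giulietti--Korchmáros curve over $\mathbb{F}_{n^6}$, with point at infinity $P_\infty$ and points $P_1,\dots,P_n$, where $P_j=(a_j,0,0)$ and $a_1,\dots,a_n$ are the distinct roots of $X^n+X=0$. Put $a=n^2-n+1$, $b=n^3$, $c=n^3+1$, and let $1\le m\le n$. If $2\le k\le a$ and $(n^2-m)c-kb>0$, then the $(m+1)$-tuple $$\bigl((n^2-m)c-kb,\;k,\;\ldots,\;k,\;k-1\bigr)$$ (with entry $(n^2-m)c-kb$ at $P_\infty$, entry $k$ at each of $P_1,\dots,P_{m-1}$, and entry $k-1$ at $P_m$) is a pure gap of the Weierstrass semigroup $H(P_\infty,P_1,\ldots,P_m)$ on $GK$.
   Context: The $GK$ curve. Let $n\ge2$ be a prime power and $q=n^3$. $GK$ is the nonsingular, absolutely irreducible projective curve in $\mathbb{P}^3$ over $\mathbb{F}_{q^2}=\mathbb{F}_{n^6}$ with affine equations $Z^{n^2-n+1}=Y\,h(X)$, $X^n+X=Y^{n+1}$, where $h(X)=\sum_{i=0}^{n}(-1)^{i+1}X^{i(n-1)}$. It has a single point at infinity $P_\infty=(1:0:0:0)$ and genus $g=\frac12(n^3+1)(n^2-2)+1$. Its function field is $\mathbb{F}_{q^2}(x,y,z)$ with $z^{n^2-n+1}=y\,h(x)$ and $x^n+x=y^{n+1}$. For $j=1,\dots,n$, $P_j=(a_j,0,0)$ with $a_j^n+a_j=0$ (all $n$ such points, which are $\mathbb{F}_{q^2}$-rational). For a divisor $G$ on a curve $\mathcal{X}$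 over a finite field $F$, $\mathcal{L}(G)=\{f\in F(\mathcal{X}) : (f)+G\ge0\}\cup\{0\}$ is the Riemann--Roch space. Weierstrass semigroup and gaps. For distinct rational points $R_1,\dots,R_r$ on $\mathcal{X}$, $H(R_1,\dots,R_r)=\{(u_1,\dots,u_r)\in\mathbb{N}_0^r : \exists f\in F(\mathcal{X}) \text{ with pole divisor } (f)_\infty=\sum_i u_iR_i\}$, where $\mathbb{N}_0$ is the set of nonnegative integers; the gap set is $G(R_1,\dots,R_r)=\mathbb{N}_0^r\setminus H(R_1,\dots,R_r)$. Pure gap. An element $(\alpha_1,\dots,\alpha_r)\in G(R_1,\dots,R_r)$ is a pure gap (of $H(R_1,\dots,R_r)$, or at $R_1,\dots,R_r$) if $\dim\mathcal{L}(\sum_{i}\alpha_iR_i)=\dim\mathcal{L}(\sum_{i}\alpha_iR_i-R_j)$ for all $j=1,\dots,r$. *)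

(* Defs.v *)
From HB Require Import structures.
From mathcomp Require Import all_boot all_order all_algebra.
From mathcomp Require Import boolp.
From mathcomp Require Import freeg.

Set Implicit Arguments.
Unset Strict Implicit.
Unset Printing Implicit Defensive.

Import Order.TTheory GRing.Theory Num.Theory.
Local Open Scope ring_scope.

(* A nonsingular projective curve over k is handled through its function
   field L, with embedding iota : k -> L; its closed points are the places of
   L over k, i.e. the normalized discrete valuations of L trivial on k. *)

(* The value +oo of a valuation at 0 is replaced by the dummy value 0, so that
   a valuation is an integer-valued function determined by its restriction to
   the nonzero elements; only the values at nonzero elements are meaningful. *)
Record place (k : fieldType) (L : fieldType) (iota : {rmorphism k -> L}) := Place {
  ord_at :> L -> int;
  ord_at0 : ord_at 0 = 0;
  ord_atM : forall f g : L, f != 0 -> g != 0 ->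
    ord_at (f * g) = ord_at f + ord_at g;
  ord_atD : forall f g : L, f != 0 -> g != 0 -> f + g != 0 ->
    Num.min (ord_at f) (ord_at g) <= ord_at (f + g);
  ord_at_const : forall c : k, c != 0 -> ord_at (iota c) = 0;
  ord_at_surj : exists t : L, ord_at t = 1
}.

HB.instance Definition _ (k L : fieldType) (iota : {rmorphism k -> L}) :=
  gen_eqMixin (place iota).
HB.instance Definition _ (k L : fieldType) (iota : {rmorphism k -> L}) :=
  gen_choiceMixin (place iota).

Section FunctionField.

Variables (k L : fieldType) (iota : {rmorphism k -> L}).
Implicit Types (P : place iota) (f : L).

Definition divisor := {freeg (place iota) / int}.

Definition point_divisor P : divisor := << 1 *g P >>.

Definition divisor_of r (R : 'I_r -> place iota) (u : 'I_r -> nat) : divisor :=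
  \sum_(i < r) point_divisor (R i) *+ u i.

(* (f)_oo = D. *)
Definition has_pole_divisor f (D : divisor) : Prop :=
  f != 0 /\ forall P, coeff P D = Num.max (- ord_at P f) 0.

Definition RR_space (G : divisor) : L -> Prop :=
  fun f => f = 0 \/ (f != 0 /\ forall P, 0 <= ord_at P f + coeff P G).

(* dim_k V = d, where V is a k-subspace of L (which is not finite dimensional
   over k). *)
Definition has_dim (V : L -> Prop) (d : nat) : Prop :=
  exists e : 'I_d -> L,
    [/\ forall i, V (e i),
        forall c : 'I_d -> k,
          \sum_(i < d) iota (c i) * e i = 0 -> forall i, c i = 0
      & forall f, V f ->
          exists c : 'I_d -> k, f = \sum_(i < d) iota (c i) * e i].

Definition same_dim (V W : L -> Prop) : Prop :=
  exists d : nat, has_dim V d /\ has_dim W d.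

Definition weierstrass_semigroup r (R : 'I_r -> place iota)
    (u : 'I_r -> nat) : Prop :=
  exists f, has_pole_divisor f (divisor_of R u).

Definition gap r (R : 'I_r -> place iota) (u : 'I_r -> nat) : Prop :=
  ~ weierstrass_semigroup R u.

Definition pure_gap r (R : 'I_r -> place iota) (u : 'I_r -> nat) : Prop :=
  gap R u /\
  forall j : 'I_r,
    same_dim (RR_space (divisor_of R u))
             (RR_space (divisor_of R u - point_divisor (R j))).

Definition vanishes_at P f : Prop := f = 0 \/ 0 < ord_at P f.

(* phi = (phi_0 : ... : phi_N) are the projective coordinate functions of the
   curve and p are homogeneous coordinates of a k-rational point of P^N: the
   place P is centered at this point, i.e. some quotients phi_i / phi_j are
   regular at P with value p_i / p_j for all i. *)
Definition centered_at N (phi : 'rV[L]_N) (p : 'rV[k]_N) P : Prop :=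
  exists j : 'I_N,
    [/\ p 0 j != 0, phi 0 j != 0
      & forall i : 'I_N,
          vanishes_at P (phi 0 i / phi 0 j - iota (p 0 i / p 0 j))].

End FunctionField.

Definition row4 (T : Type) (t0 t1 t2 t3 : T) : 'rV[T]_4 :=
  \row_(i < 4) tnth [tuple t0; t1; t2; t3] i.

Section GK.

Variables (n : nat) (k L : fieldType) (iota : {rmorphism k -> L}).

Definition GK_h (t : L) : L :=
  \sum_(0 <= i < n.+1) (-1) ^+ i.+1 * t ^+ (i * (n - 1))%N.

(* L = k(x, y, z) is the function field of the GK curve. As the affine curve is
   irreducible, the two equations together with the transcendence of x
   determine the ideal of relations between x, y, z, and so (L, x, y, z) up to
   isomorphism over k. *)
Record GK_function_field (x y z : L) : Prop := GKFunctionField {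
  GK_eq_z : z ^+ (n ^ 2 - n + 1)%N = y * GK_h x;
  GK_eq_y : x ^+ n + x = y ^+ n.+1;
  GK_transc : ~ algebraicOver iota x;
  GK_gen : forall S : {pred L}, divring_closed S ->
    (forall c : k, iota c \in S) -> x \in S -> y \in S -> z \in S ->
    forall f : L, f \in S
}.

(* Projective coordinates (X : Y : Z : T), the affine part being T != 0. *)
Definition GK_coords (x y z : L) : 'rV[L]_4 := row4 x y z 1.

Definition GK_point_infty : 'rV[k]_4 := row4 1 0 0 0.

Definition GK_point (a : k) : 'rV[k]_4 := row4 a 0 0 1.

End GK.

(* Main.v *)
Require Import Defs.
From HB Require Import structures.
From mathcomp Require Import all_boot all_order all_algebra all_field.
From mathcomp Require Import boolp freeg.
From mathcomp Require Import ring zify.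

(* In characteristic p the equation of the curve reads z^a = y^(n^2) - y, so the
   coordinate ring A of the affine curve is free over F[z] on the x^i y^j with
   i < n, j < n^2: their orders at Pinf are distinct.  The projection to z is
   unramified at every affine point, which makes A integrally closed: writing a
   function as g / D(z) with D of minimal degree, a root of D would yield an
   affine point, with its discrete valuation ring, at which g is a unit.

   Multiplying f in L(G) by the product of the x - a_s therefore gives an element
   of A, that is a sum of terms T(x) y^j z^l with j <= n and l < a.  Their orders
   are pairwise distinct both at Pinf and at each P_s, so every term satisfies the
   order bounds imposed by G; a computation with these orders shows that
   none of the bounds at Pinf, P_1, ..., P_m is ever attained.  Hence
   L(G) = L(G - R_i) for every i, and G is not a pole divisor. *)

(** Two normal forms of A are needed. The one over F[z] serves to construct places, but at a P_s
    with a_s nonzero every x^i is a unit, so its terms have clashing orders there. In the form over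
    F[x] the term T(x) y^j z^l has order c mu + a j + l at P_s, where mu is the multiplicity of a_s
    in T, and order -(c deg T + n a j + b l) at Pinf; j and l can be read off from either number
    because c = (n+1)a and b = c - 1.

    As F is finite, the coordinates of a point are fixed by w -> w^N for some power N of |F|, and
    z^N - z, which has coefficients in F, is the uniformizer.

    The product of the x - a_s has order c at each P_s and -mc at Pinf. This turns the entry (n^2 -
    m)c - kb into the bound c deg T + n a j + b l + kb <= n^2 c, from which m has disappeared. *)

Set Implicit Arguments.
Unset Strict Implicit.
Unset Printing Implicit Defensive.

Import Order.TTheory GRing.Theory Num.Theory.
Local Open Scope ring_scope.

(** * Places and ultrametric sums *)

Section PlaceTheory.

Variables (k L : fieldType) (iota : {rmorphism k -> L}) (v : place iota).
Implicit Types f g : L.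

Lemma ord_at1 : v 1 = 0.
Proof. by rewrite -(rmorph1 iota) ord_at_const ?oner_eq0. Qed.

Lemma ordN f : v (- f) = v f.
Proof.
have [->|f0] := eqVneq f 0; first by rewrite oppr0.
rewrite -mulN1r ord_atM ?oppr_eq0 ?oner_eq0 //.
by rewrite -(rmorph1 iota) -rmorphN ord_at_const ?add0r // oppr_eq0 oner_eq0.
Qed.

Lemma ordV f : v f^-1 = - v f.
Proof.
have [->|f0] := eqVneq f 0; first by rewrite invr0 ord_at0 oppr0.
apply/eqP; rewrite -addr_eq0 -ord_atM ?invr_eq0 //.
by rewrite mulVf // ord_at1.
Qed.

Lemma ord_div f g : f != 0 -> g != 0 -> v (f / g) = v f - v g.
Proof. by move=> f0 g0; rewrite ord_atM ?invr_eq0 // ordV. Qed.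

Lemma ordX f m : f != 0 -> v (f ^+ m) = v f *+ m.
Proof.
move=> f0; elim: m => [|m IH]; first by rewrite expr0 ord_at1 mulr0n.
by rewrite exprS ord_atM ?expf_neq0 // IH mulrS.
Qed.

Lemma ordD_ge f g (e : int) : f + g != 0 ->
  (f != 0 -> e <= v f) -> (g != 0 -> e <= v g) -> e <= v (f + g).
Proof.
have [->|f0] := eqVneq f 0; first by rewrite add0r => g0 _; apply.
have [->|g0] := eqVneq g 0; first by rewrite addr0 => _ + _; apply.
move=> fg0 /(_ isT) ef /(_ isT) eg; apply: le_trans (ord_atD v f0 g0 fg0).
by rewrite le_min ef eg.
Qed.

Lemma ordD_lt f g : f != 0 -> (g != 0 -> v f < v g) ->
  f + g != 0 /\ v (f + g) = v f.
Proof.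
move=> f0; have [->|g0] := eqVneq g 0; first by rewrite addr0.
move=> /(_ isT) fg.
have fg0 : f + g != 0.
  by apply: contraTneq fg => /eqP; rewrite addr_eq0 => /eqP ->; rewrite ordN ltxx.
split=> //; apply/eqP; rewrite eq_le; apply/andP; split; last first.
  by apply: ordD_ge => // _; apply: ltW.
have := ord_atD v fg0 (g := - g); rewrite oppr_eq0 addrK ordN => /(_ g0 f0).
by rewrite ge_min [v g <= _]leNgt fg orbF.
Qed.

Lemma ord_sum_ge (I : Type) (r : seq I) (P : pred I) (t : I -> L) (e : int) :
  (forall i, P i -> t i != 0 -> e <= v (t i)) ->
  \sum_(i <- r | P i) t i != 0 -> e <= v (\sum_(i <- r | P i) t i).
Proof.
move=> te; elim/big_rec: _ => [|i s Pi IH ns0]; first by rewrite eqxx.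
by apply: ordD_ge => // t0; apply: te.
Qed.

(** The term of least order dominates. This is used in two ways: a vanishing sum forces all terms to
    vanish, which gives linear independence, and the order of a sum bounds the order of every term
    from below. *)
Lemma ord_sum_distinct (I : eqType) (r : seq I) (t : I -> L) : uniq r ->
  {in r &, forall i j, t i != 0 -> t j != 0 -> v (t i) = v (t j) -> i = j} ->
  {in r, forall i, t i = 0} \/
  exists2 i0, i0 \in r &
    [/\ t i0 != 0, \sum_(i <- r) t i != 0, v (\sum_(i <- r) t i) = v (t i0)
      & {in r, forall i, t i != 0 -> v (t i0) <= v (t i)}].
Proof.
elim: r => [|j r IH] /=; first by left.
case/andP=> jr ur inj.
have inj' : {in r &, forall i j, t i != 0 -> t j != 0 -> v (t i) = v (t j) -> i = j}.
  by move=> i i' ir ir'; apply: inj; rewrite inE ?ir ?ir' orbT.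
rewrite big_cons; have {IH} := IH ur inj'.
have [tj0|tj0] := eqVneq (t j) 0.
  case=> [r0|[i0 i0r [ti0 s0 vs mini]]].
    by left=> i; rewrite inE => /predU1P[->//|/r0].
  right; exists i0; first by rewrite inE i0r orbT.
  by rewrite tj0 add0r; split=> // i; rewrite inE => /predU1P[->|/mini//];
     rewrite tj0 eqxx.
case=> [r0|[i0 i0r [ti0 s0 vs mini]]].
  have s0 : \sum_(i <- r) t i = 0 by rewrite big_seq big1.
  right; exists j; rewrite ?mem_head // s0 addr0; split=> // i.
  by rewrite inE => /predU1P[->//|/r0->]; rewrite eqxx.
right.
have nij : v (t i0) != v (t j).
  apply: contraNneq jr => e; suff <- : i0 = j by [].
  by apply: inj; rewrite ?inE ?eqxx ?i0r ?orbT.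
case: (ltgtP (v (t i0)) (v (t j))) nij => // lt _.
- have [||n0 e] := @ordD_lt (\sum_(i <- r) t i) (t j) => //; first by rewrite vs.
  exists i0; first by rewrite inE i0r orbT.
  rewrite addrC e; split=> // i; rewrite inE => /predU1P[->|/mini//] _.
  exact: ltW.
- have [||n0 e] := @ordD_lt (t j) (\sum_(i <- r) t i) => //; first by rewrite vs.
  exists j; first by rewrite mem_head.
  rewrite e; split=> // i; rewrite inE => /predU1P[->//|ir ti].
  exact: le_trans (ltW lt) (mini _ ir ti).
Qed.

Lemma ord_sumT_distinct (I : finType) (t : I -> L) :
  (forall i j, t i != 0 -> t j != 0 -> v (t i) = v (t j) -> i = j) ->
  (forall i, t i = 0) \/
  exists i0,
    [/\ t i0 != 0, \sum_i t i != 0, v (\sum_i t i) = v (t i0)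
      & forall i, t i != 0 -> v (t i0) <= v (t i)].
Proof.
move=> inj; have [|r0|[i0 _ [t0 s0 vs mini]]] :=
    @ord_sum_distinct I (index_enum I) t (index_enum_uniq I).
- by move=> i j _ _; apply: inj.
- by left=> i; apply: r0; rewrite mem_index_enum.
- by right; exists i0; split=> // i; apply: mini; rewrite mem_index_enum.
Qed.

Lemma ord_horner_ge f (p : {poly k}) : f != 0 -> 0 <= v f ->
  (map_poly iota p).[f] != 0 -> 0 <= v (map_poly iota p).[f].
Proof.
move=> f0 vf; rewrite horner_coef; apply: ord_sum_ge => i _.
rewrite coef_map mulf_eq0 negb_or expf_eq0 (negPf f0) andbF andbT fmorph_eq0 => p0.
by rewrite ord_atM ?fmorph_eq0 ?expf_neq0 // ord_at_const // ordX // add0r mulrn_wge0.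
Qed.

(** At a pole the powers of [f] have distinct orders, and the leading term has the least one. *)
Lemma ord_horner_pole f (p : {poly k}) : v f < 0 -> p != 0 ->
  (map_poly iota p).[f] != 0 /\
  v (map_poly iota p).[f] = v f *+ (size p).-1.
Proof.
move=> vf p0.
have f0 : f != 0 by apply: contraTneq vf => ->; rewrite ord_at0.
have vt (c : k) i : c != 0 -> v (iota c * f ^+ i) = v f *+ i.
  by move=> c0; rewrite ord_atM ?fmorph_eq0 ?expf_neq0 // ord_at_const // ordX // add0r.
have nat_inj (i j : nat) : v f *+ i = v f *+ j -> i = j.
  move=> e; have /eqP := e; rewrite -subr_eq0; case: (leqP i j) => ij.
    rewrite -opprB -mulrnBr // oppr_eq0 mulrn_eq0 (lt_eqF vf) orbF subn_eq0 => ji.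
    by apply/anti_leq; rewrite ij.
  by rewrite -mulrnBr ?(ltnW ij) // mulrn_eq0 (lt_eqF vf) orbF subn_eq0 leqNgt ij.
rewrite horner_coef size_map_poly.
have ps : p`_(size p).-1 != 0 by rewrite -lead_coefE lead_coef_eq0.
have sp : ((size p).-1 < size p)%N by rewrite prednK // size_poly_gt0.
pose t (i : 'I_(size p)) := (map_poly iota p)`_i * f ^+ i.
have t0 i : t i != 0 -> p`_i != 0.
  by apply: contraNneq => pi; rewrite /t coef_map mulf_eq0 fmorph_eq0 pi eqxx.
have tv i : t i != 0 -> v (t i) = v f *+ i.
  by move=> /t0 pi; rewrite /t coef_map vt.
have tl : t (Ordinal sp) != 0.
  by rewrite /t coef_map mulf_eq0 fmorph_eq0 (negPf ps) expf_neq0.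
have [|r0|[i0 [ti0 s0 vs mini]]] := @ord_sumT_distinct _ t.
- by move=> i j ti tj; rewrite !tv // => /nat_inj; apply: val_inj.
- by rewrite r0 eqxx in tl.
split; first exact: s0.
rewrite vs tv //; congr (_ *+ _); apply/anti_leq.
rewrite -ltnS prednK ?size_poly_gt0 // ltn_ord /=.
have := mini _ tl; rewrite !tv //= leqNgt => h; apply/negP => lt.
have : v f *+ i0 - v f *+ (size p).-1 <= 0 by rewrite subr_le0.
rewrite -opprB -mulrnBr ?(ltnW lt) // oppr_le0 leNgt pmulrn_llt0 ?subn_gt0 //.
by rewrite vf.
Qed.

End PlaceTheory.

(** * Monogenic ring extensions as spans of powers *)

Section PowSpan.

Variable R : comNzRingType.
Implicit Types (S C : R -> Prop) (w r s : R).

Definition subring S :=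
  [/\ S 0, S 1, forall r s, S r -> S s -> S (r + s)
    & forall r s, S r -> S s -> S (r * s)].

Lemma subringX S r i : subring S -> S r -> S (r ^+ i).
Proof.
case=> _ S1 _ SM Sr; elim: i => [|i IH]; first by rewrite expr0.
by rewrite exprS; apply: SM.
Qed.

Lemma subring_sum S (I : Type) (s : seq I) (P : pred I) (f : I -> R) :
  subring S -> (forall i, P i -> S (f i)) -> S (\sum_(i <- s | P i) f i).
Proof. by case=> S0 _ SD _ Sf; elim/big_ind: _. Qed.

Definition pow_span S w d r :=
  exists2 s : 'I_d -> R, forall i, S (s i) & r = \sum_(i < d) s i * w ^+ i.

Lemma pow_span_min S w d C : subring C -> (forall r, S r -> C r) -> C w ->
  forall r, pow_span S w d r -> C r.
Proof.
move=> sC SC Cw r [s Ss ->]; apply: subring_sum => // i _.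
by case: (sC) => _ _ _ CM; apply: CM; [apply/SC/Ss|apply: subringX].
Qed.

Section Closure.

Variables (S : R -> Prop) (w : R) (d : nat).
Hypotheses (sS : subring S) (d_gt0 : (0 < d)%N).

Lemma pow_span0 : pow_span S w d 0.
Proof.
case: sS => S0 _ _ _; exists (fun=> 0) => //.
by rewrite big1 // => i _; rewrite mul0r.
Qed.

Lemma pow_spanD r s :
  pow_span S w d r -> pow_span S w d s -> pow_span S w d (r + s).
Proof.
case: sS => _ _ SD _ [f Sf ->] [g Sg ->]; exists (fun i => f i + g i).
  by move=> i; apply: SD.
by rewrite -big_split; apply: eq_bigr => i _; rewrite mulrDl.
Qed.

Lemma pow_span_scale c r : S c -> pow_span S w d r -> pow_span S w d (c * r).
Proof.
case: sS => _ _ _ SM Sc [f Sf ->]; exists (fun i => c * f i).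
  by move=> i; apply: SM.
by rewrite mulr_sumr; apply: eq_bigr => i _; rewrite mulrA.
Qed.

Lemma pow_span_gen i : (i < d)%N -> pow_span S w d (w ^+ i).
Proof.
case: sS => S0 S1 _ _ lt; exists (fun j : 'I_d => if j == i :> nat then 1 else 0).
  by move=> j; case: ifP.
rewrite (bigD1 (Ordinal lt)) //= eqxx mul1r big1 ?addr0 // => j.
by rewrite -val_eqE /= => /negPf->; rewrite mul0r.
Qed.

Lemma pow_span_sub r : S r -> pow_span S w d r.
Proof.
by move=> Sr; rewrite -[r]mulr1 -(expr0 w); apply/pow_span_scale/pow_span_gen.
Qed.

Hypothesis w_rel : pow_span S w d (w ^+ d).

(** A factor [w] raises every exponent by one; only the top power leaves the range, and [w_rel]
    brings it back. *)
Lemma pow_span_mulX i r : pow_span S w d r -> pow_span S w d (w ^+ i * r).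
Proof.
elim: i r => [|i IH] r Hr; first by rewrite expr0 mul1r.
rewrite exprSr -mulrA; apply: IH; case: Hr => s Ss ->.
rewrite mulr_sumr; elim/big_ind: _ => [||j _]; [exact: pow_span0|exact: pow_spanD|].
rewrite mulrCA -exprS; apply: pow_span_scale => //.
by have := ltn_ord j; rewrite leq_eqVlt => /predU1P[->//|]; apply: pow_span_gen.
Qed.

Lemma pow_span_subring : subring (pow_span S w d).
Proof.
split; [exact: pow_span0|by apply: pow_span_sub; case: sS|exact: pow_spanD|].
move=> r s [f Sf ->] Hs; rewrite mulr_suml.
elim/big_ind: _ => [||j _]; [exact: pow_span0|exact: pow_spanD|].
by rewrite -mulrA; apply: pow_span_scale => //; apply: pow_span_mulX.
Qed.

(** Obtained by multiplying 1 by [w], so that [d = 1], where [w] is not among the generators, is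
    covered. *)
Lemma pow_span_mem : pow_span S w d w.
Proof.
have := @pow_span_mulX 1 1; rewrite expr1 mulr1; apply.
by apply: pow_span_sub; case: sS.
Qed.

End Closure.

Variables (F : nzRingType) (iota : {rmorphism F -> R}).

Definition poly_val w r := exists p : {poly F}, r = (map_poly iota p).[w].

Lemma poly_val_const w c : poly_val w (iota c).
Proof. by exists c%:P; rewrite map_polyC hornerC. Qed.

Lemma poly_val_mem w : poly_val w w.
Proof. by exists 'X; rewrite map_polyX hornerX. Qed.

Lemma poly_val_subring w : subring (poly_val w).
Proof.
split.
- by rewrite -(rmorph0 iota); apply: poly_val_const.
- by rewrite -(rmorph1 iota); apply: poly_val_const.
- by move=> _ _ [p ->] [q ->]; exists (p + q); rewrite rmorphD hornerD.
- by move=> _ _ [p ->] [q ->]; exists (p * q); rewrite rmorphM hornerM.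
Qed.

Lemma poly_val_min w C : subring C -> (forall c, C (iota c)) -> C w ->
  forall r, poly_val w r -> C r.
Proof.
move=> sC Cc Cw _ [p ->]; rewrite horner_coef; apply: subring_sum => // i _.
rewrite coef_map; case: (sC) => _ _ _ CM; apply: CM; first exact: Cc.
exact: subringX.
Qed.

End PowSpan.

(** * Integral elements over a polynomial subring *)

Section Integral.

Variables (R0 : comNzRingType) (L : fieldType) (ev : {rmorphism R0 -> L}).

Lemma integral_subring : subring (integralOver ev).
Proof.
split; [exact: integral0|exact: integral1| |] => r s.
  exact: integral_add.
exact: integral_mul.
Qed.

(** In an algebraic relation for [h], factors X are stripped off while the constant term maps to 0.
    The first nonzero constant term is then a multiple of [h], and the cofactor is a polynomial in
    [h]. This turns denominators from A into denominators from F[z]. *)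
Lemma integral_divides (A : L -> Prop) (h : L) :
  subring A -> (forall r, A (- ev r)) -> A h -> h != 0 -> integralOver ev h ->
  exists g r, [/\ A g, h * g = ev r & ev r != 0].
Proof.
move=> sA Aev Ah h0 [p mp].
have : map_poly ev p != 0 by apply/monic_neq0/monic_map.
have {mp}: True by [].
elim/poly_ind: p => [_|p c IH _]; first by rewrite rmorph0 eqxx.
rewrite rmorphD rmorphM /= map_polyX map_polyC /= => p0.
rewrite rootE hornerMXaddC => /eqP r0.
have [c0|c0] := eqVneq (ev c) 0; last first.
  exists (- (map_poly ev p).[h]), c; split=> //; last first.
    by rewrite mulrN mulrC; apply/eqP; rewrite eq_sym -addr_eq0 addrC r0.
  rewrite horner_coef -sumrN; apply: subring_sum => // i _.
  rewrite coef_map -mulNr; case: (sA) => _ _ _ AM; apply: AM; first exact: Aev.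
  exact: subringX.
move: p0 r0; rewrite c0 polyC0 !addr0 => p0 /eqP; rewrite mulf_eq0 (negPf h0) orbF => r0.
by apply: IH => //; apply: contraNneq p0 => ->; rewrite mul0r.
Qed.

End Integral.

(** * Finite-dimensional subspaces over a finite field *)

Section FiniteDim.

Variables (F : finFieldType) (L : fieldType) (iota : {rmorphism F -> L}).

(** Finiteness of F allows a counting argument: an independent family of length [d] injects F^d into
    the finite set of coefficient vectors on [b], which bounds [d]. An independent family of maximal
    length is a basis. *)
Lemma has_dim_sub_finite (V : L -> Prop) (I : finType) (b : I -> L) :
  (forall d (e : 'I_d -> L) (c : 'I_d -> F),
     (forall i, V (e i)) -> V (\sum_i iota (c i) * e i)) ->
  (forall f, V f -> exists c : I -> F, f = \sum_i iota (c i) * b i) ->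
  exists d, has_dim iota V d.
Proof.
move=> Vlin Vsub.
pose indep d := exists e : 'I_d -> L, (forall i, V (e i)) /\
  forall c : 'I_d -> F, \sum_(i < d) iota (c i) * e i = 0 -> forall i, c i = 0.
have ex : exists d, `[< indep d >].
  by exists 0%N; apply/asboolP; exists (fun=> 0); split=> [[]|? _ []].
have bnd d : `[< indep d >] -> (d <= #|{ffun I -> F}|)%N.
  case/asboolP=> e [Ve ind].
  have /choice[g gP] (c : {ffun 'I_d -> F}) :
      exists g : {ffun I -> F}, \sum_i iota (c i) * e i = \sum_i iota (g i) * b i.
    have [|g ->] := Vsub (\sum_i iota (c i) * e i); first exact: Vlin.
    by exists (finfun g); apply: eq_bigr => i _; rewrite ffunE.
  have ginj : injective g.
    move=> c c' gcc; apply/ffunP => i; apply/eqP; rewrite -subr_eq0; apply/eqP.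
    apply: (ind (fun i => c i - c' i)).
    under eq_bigr do rewrite rmorphB mulrBl.
    by rewrite big_split sumrN /= !gP gcc subrr.
  apply: leq_trans (leq_card g ginj); rewrite card_ffun card_ord.
  by apply/ltnW/ltn_expl/card_finNzRing_gt1.
case: (ex_maxnP ex bnd) => d /asboolP[e [Ve ind]] dmax.
exists d, e; split=> // f Vf; apply: contrapT => nf.
suff /asboolP/dmax : indep d.+1 by rewrite ltnn.
exists (fun i => oapp e f (unlift ord0 i)); split.
  by move=> i; case: (unlift ord0 i).
move=> c; rewrite big_ord_recl unlift_none /=.
under eq_bigr do rewrite liftK /=.
have [c0|c0] := eqVneq (c ord0) 0.
  rewrite c0 rmorph0 mul0r add0r => /ind h i.
  by case: (unliftP ord0 i) => [j|] ->.
move=> e0; case: nf; exists (fun i => - (c ord0)^-1 * c (fintype.lift ord0 i)).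
under eq_bigr do rewrite rmorphM -mulrA.
rewrite -mulr_sumr -[X in _ * X](addKr (iota (c ord0) * f)) e0 addr0.
by rewrite rmorphN mulrNN fmorphV mulKf // fmorph_eq0.
Qed.

End FiniteDim.

(** * Discrete valuation rings from specializations *)

(* B is the graph of a ring morphism from a subring of L to K. *)
Section Specialization.

Variables (k L K : fieldType) (iota : {rmorphism k -> L}) (jota : {rmorphism k -> K}).
Variable B : L -> K -> Prop.
Hypothesis B_const : forall c, B (iota c) (jota c).
Hypothesis BD : forall g h ga et, B g ga -> B h et -> B (g + h) (ga + et).
Hypothesis BM : forall g h ga et, B g ga -> B h et -> B (g * h) (ga * et).
Hypothesis B0 : forall ga, B 0 ga -> ga = 0.

(* f lies in the localization of the domain of B at the kernel of B, with residue ka. *)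
Definition has_value (f : L) (ka : K) := exists g ga h et,
  [/\ B g ga, B h et, et != 0, f = g / h & ka = ga / et].

Lemma specialization_neq0 h et : B h et -> et != 0 -> h != 0.
Proof. by move=> Bh et0; apply: contraNneq et0 => h0; rewrite (B0 (_ : B 0 et)) // -h0. Qed.

Lemma has_value_sub g ga : B g ga -> has_value g ga.
Proof.
exists g, ga, 1, 1; rewrite !divr1 oner_eq0; split=> //.
by rewrite -(rmorph1 iota) -(rmorph1 jota).
Qed.

Lemma has_valueD f1 f2 k1 k2 :
  has_value f1 k1 -> has_value f2 k2 -> has_value (f1 + f2) (k1 + k2).
Proof.
move=> [g1 [c1 [h1 [e1 [B1 D1 n1 -> ->]]]]] [g2 [c2 [h2 [e2 [B2 D2 n2 -> ->]]]]].
exists (g1 * h2 + g2 * h1), (c1 * e2 + c2 * e1), (h1 * h2), (e1 * e2).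
split; [by apply: BD; apply: BM|by apply: BM|by rewrite mulf_neq0| |].
  by rewrite addf_div ?(specialization_neq0 D1) ?(specialization_neq0 D2).
by rewrite addf_div.
Qed.

Lemma has_valueM f1 f2 k1 k2 :
  has_value f1 k1 -> has_value f2 k2 -> has_value (f1 * f2) (k1 * k2).
Proof.
move=> [g1 [c1 [h1 [e1 [B1 D1 n1 -> ->]]]]] [g2 [c2 [h2 [e2 [B2 D2 n2 -> ->]]]]].
exists (g1 * g2), (c1 * c2), (h1 * h2), (e1 * e2).
by split; [exact: BM|exact: BM|rewrite mulf_neq0|rewrite mulf_div|rewrite mulf_div].
Qed.

Lemma has_valueV f ka : has_value f ka -> ka != 0 -> has_value f^-1 ka^-1.
Proof.
move=> [g [c [h [e [Bg Bh e0 -> ->]]]]].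
rewrite mulf_eq0 invr_eq0 negb_or => /andP[c0 _].
by exists h, e, g, c; split=> //; rewrite invf_div.
Qed.

Lemma has_valueX f ka i : has_value f ka -> has_value (f ^+ i) (ka ^+ i).
Proof.
move=> fk; elim: i => [|i IH]; last by rewrite !exprS; apply: has_valueM.
rewrite !expr0 -(rmorph1 iota) -(rmorph1 jota); exact: has_value_sub.
Qed.

Lemma has_value_const c : has_value (iota c) (jota c).
Proof. exact: has_value_sub. Qed.

Lemma has_valueN f ka : has_value f ka -> has_value (- f) (- ka).
Proof.
move=> fk; rewrite -mulN1r -[X in has_value _ X]mulN1r; apply: has_valueM => //.
by rewrite -(rmorph1 iota) -(rmorph1 jota) -!rmorphN; apply: has_value_const.
Qed.

Lemma has_value0 ka : has_value 0 ka -> ka = 0.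
Proof.
move=> [g [c [h [e [Bg Bh e0 + ->]]]]].
move/esym/eqP; rewrite mulf_eq0 invr_eq0 (negPf (specialization_neq0 Bh e0)) orbF => /eqP g0.
by rewrite (B0 (ga := c)) ?mul0r // -g0.
Qed.

Lemma has_value_uniq f k1 k2 : has_value f k1 -> has_value f k2 -> k1 = k2.
Proof.
move=> f1 f2; apply/eqP; rewrite -subr_eq0; apply/eqP/has_value0.
by rewrite -(subrr f); apply: has_valueD => //; apply: has_valueN.
Qed.

Definition value_unit (f : L) := exists2 ka, has_value f ka & ka != 0.

Lemma value_unitM f g : value_unit f -> value_unit g -> value_unit (f * g).
Proof.
move=> [a fa a0] [b gb b0]; exists (a * b); last by rewrite mulf_neq0.
exact: has_valueM.
Qed.

Lemma value_unitV f : value_unit f -> value_unit f^-1.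
Proof. by move=> [a fa a0]; exists a^-1; [exact: has_valueV|rewrite invr_eq0]. Qed.

Lemma value_unit_const c : c != 0 -> value_unit (iota c).
Proof. by exists (jota c); [exact: has_value_const|rewrite fmorph_eq0]. Qed.

Lemma value_unit1 : value_unit 1.
Proof. by rewrite -(rmorph1 iota); apply/value_unit_const/oner_neq0. Qed.

Lemma value_unit_neq0 f : value_unit f -> f != 0.
Proof.
by move=> [a fa]; apply: contraNneq => f0; rewrite f0 in fa; rewrite (has_value0 fa).
Qed.

Variable t : L.
Hypothesis t_neq0 : t != 0.
Hypothesis Bt : B t 0.
Hypothesis t_uniformizer : forall g, B g 0 ->
  exists f ka, has_value f ka /\ g = t * f.
Hypothesis t_bounded : forall g ga, B g ga -> g != 0 ->
  exists M : nat, forall (e : nat) f ka, has_value f ka -> g = t ^+ e * f -> (e <= M)%N.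
Hypothesis B_frac : forall f, exists g ga h et,
  [/\ B g ga, B h et, h != 0 & f = g / h].

Lemma has_value_uniformizer f : has_value f 0 ->
  exists f' ka, has_value f' ka /\ f = t * f'.
Proof.
move=> [g [c [h [e [Bg Bh e0 -> /esym/eqP]]]]].
rewrite mulf_eq0 invr_eq0 (negPf e0) orbF => /eqP c0.
have [|g' [c' [gc ->]]] := @t_uniformizer g; first by rewrite -c0.
exists (g' / h), (c' / e); split; last by rewrite mulrA.
by apply: has_valueM => //; apply: has_valueV e0; apply: has_value_sub.
Qed.

(** Take the largest power of [t] that divides [g] in the local ring. If the cofactor were not a
    unit its residue would be 0, and another [t] would split off. *)
Lemma specialization_decomp g ga : B g ga -> g != 0 ->
  exists (e : nat) u, value_unit u /\ g = t ^+ e * u.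
Proof.
move=> Bg g0; have [M bM] := t_bounded Bg g0.
pose Q e := `[< exists f ka, has_value f ka /\ g = t ^+ e * f >].
have ex : exists e, Q e.
  by exists 0%N; apply/asboolP; exists g, ga; rewrite expr0 mul1r; split=> //; apply: has_value_sub.
have bnd e : Q e -> (e <= M)%N by move/asboolP=> [f [ka [fk ge]]]; exact: bM fk ge.
case: (ex_maxnP ex bnd) => e /asboolP[f [ka [fk ge]]] emax.
exists e, f; split=> //; exists ka => //; apply/eqP => ka0.
rewrite ka0 in fk; have [f' [c [f'c ff']]] := has_value_uniformizer fk.
suff /emax : Q e.+1 by rewrite ltnn.
by apply/asboolP; exists f', c; split=> //; rewrite ge ff' exprSr mulrA.
Qed.

Lemma decomp f : f != 0 -> exists (i : int) u, value_unit u /\ f = t ^ i * u.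
Proof.
have [g [ga [h [et [Bg Bh h0 ->]]]]] := B_frac f.
rewrite mulf_eq0 negb_or => /andP[g0 _].
have [e1 [u1 [U1 ->]]] := specialization_decomp Bg g0.
have [e2 [u2 [U2 ->]]] := specialization_decomp Bh h0.
exists (e1%:Z - e2%:Z), (u1 / u2); split.
  by apply: value_unitM => //; apply: value_unitV.
by rewrite expfzDr // -invr_expz -!exprnP mulf_div.
Qed.

(** A negative [i] would write the unit [u] as a positive power of [t] times an element of the local
    ring, giving it residue 0. *)
Lemma decomp_value f ka i u : has_value f ka -> value_unit u -> f = t ^ i * u ->
  0 <= i /\ (0 < i) = (ka == 0).
Proof.
move=> fk Uu; case: i => [[|i]|i].
- rewrite expr0z mul1r => fu; split=> //; case: Uu => kb ub kb0.
  by apply/esym/negbTE; rewrite (has_value_uniq fk (k2 := kb)) // fu.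
- rewrite -exprnP => fu; split=> //; apply/esym/eqP.
  case: Uu => kb ub kb0; apply: has_value_uniq fk _; rewrite fu.
  have -> : (0 : K) = 0 ^+ i.+1 * kb by rewrite expr0n mul0r.
  by apply: has_valueM => //; apply/has_valueX/has_value_sub.
- rewrite NegzE -invr_expz -exprnP => fu; case: Uu => kb ub /eqP[].
  apply: has_value_uniq ub _; have -> : u = t ^+ i.+1 * f.
    by rewrite fu mulVKf // expf_neq0.
  have -> : (0 : K) = 0 ^+ i.+1 * ka by rewrite expr0n mul0r.
  by apply: has_valueM => //; apply/has_valueX/has_value_sub.
Qed.

Lemma decomp_uniq i j u w : value_unit u -> value_unit w ->
  t ^ i * u = t ^ j * w -> i = j.
Proof.
move=> Uu Uw e.
have [ka uk ka0] := value_unitM Uu (value_unitV Uw).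
have w0 := value_unit_neq0 Uw.
have : u / w = t ^ (j - i) * 1.
  rewrite mulr1 addrC expfzDr // -invr_expz; apply: (mulfI (expfz_neq0 i t_neq0)).
  by rewrite mulrA e mulVKf ?expfz_neq0 // mulfK.
move/(decomp_value uk value_unit1) => [].
rewrite (negPf ka0) lt_neqAle => ->; rewrite andbT => /negbFE/eqP/esym/eqP.
by rewrite subr_eq0 => /eqP.
Qed.

(** The local ring has the principal maximal ideal (t), and no nonzero element is divisible by all
    powers of [t]: it is a discrete valuation ring, and the place is the exponent of [t]. *)
Lemma specialization_place : exists P : place iota,
  [/\ forall f ka, has_value f ka -> f != 0 -> 0 <= P f,
      forall f ka, has_value f ka -> ka != 0 -> P f = 0
    & forall f, has_value f 0 -> f != 0 -> 0 < P f].
Proof.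
have ex f : exists i : int, (f = 0 -> i = 0) /\
    (f != 0 -> exists2 u, value_unit u & f = t ^ i * u).
  have [->|f0] := eqVneq f 0; first by exists 0.
  have [i [u [Uu fu]]] := decomp f0.
  by exists i; split=> [e|_]; [rewrite e eqxx in f0|exists u].
have [v vP] := choice ex.
have v0 : v 0 = 0 by case: (vP 0) => + _; apply.
have vdec f : f != 0 -> exists2 u, value_unit u & f = t ^ v f * u.
  by case: (vP f).
have vE i u : value_unit u -> v (t ^ i * u) = i.
  move=> Uu; have [|w Uw e] := vdec (t ^ i * u).
    by rewrite mulf_neq0 ?expfz_neq0 //; apply: value_unit_neq0.
  exact: decomp_uniq (esym e).
have v_val f ka : has_value f ka -> f != 0 -> 0 <= v f /\ (0 < v f) = (ka == 0).
  by move=> fk /vdec[u Uu fu]; apply: decomp_value fu.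
have vM f g : f != 0 -> g != 0 -> v (f * g) = v f + v g.
  move=> /vdec[u Uu fu] /vdec[w Uw gw].
  by rewrite {1}fu {1}gw mulrACA -expfzDr // vE //; apply: value_unitM.
have vD f g : f != 0 -> g != 0 -> f + g != 0 -> Num.min (v f) (v g) <= v (f + g).
  wlog le : f g / v f <= v g.
    case: (leP (v f) (v g)) => h Hw f0 g0 fg0.
      by have := Hw _ _ h f0 g0 fg0; rewrite (min_idPl h).
    by have := Hw _ _ (ltW h) g0 f0; rewrite addrC (min_idPl (ltW h)); apply.
  rewrite (min_idPl le) => f0 g0 fg0.
  have [u [ka uk ka0] fu] := vdec _ f0; have [w [kb wk kb0] gw] := vdec _ g0.
  have [s Us fgs] := vdec _ fg0.
  have [m vm] : exists m : nat, v g - v f = m.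
    by exists `|v g - v f|%N; rewrite gez0_abs // subr_ge0.
  (* The quotient of f + g by t^(v f) lies in the local ring, hence has nonnegative order. *)
  have : has_value (u + t ^+ m * w) (ka + 0 ^+ m * kb).
    by apply: has_valueD => //; apply: has_valueM => //; apply/has_valueX/has_value_sub.
  have -> : u + t ^+ m * w = t ^ (v (f + g) - v f) * s.
    apply: (mulfI (expfz_neq0 (v f) t_neq0)).
    rewrite mulrA -expfzDr // subrKC -fgs mulrDr -fu exprnP -vm mulrA -expfzDr //.
    by rewrite subrKC -gw.
  by move=> h; have [+ _] := decomp_value h Us erefl; rewrite subr_ge0.
have vconst c : c != 0 -> v (iota c) = 0.
  by move=> c0; rewrite -[iota c]mul1r -(expr0z t) vE //; apply: value_unit_const.
have vsurj : exists s, v s = 1.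
  by exists t; rewrite -{1}[t]expr1z -[t ^ 1]mulr1 vE //; apply: value_unit1.
exists (Place v0 vM vD vconst vsurj); split=> f /=.
- by move=> ka fk f0; have [] := v_val f ka fk f0.
- move=> ka fk ka0; have f0 : f != 0 by apply: value_unit_neq0; exists ka.
  have [le] := v_val f ka fk f0; rewrite (negPf ka0) => /negbT.
  by rewrite -leNgt => ge; apply/le_anti; rewrite ge.
- by move=> fk f0; have [_ ->] := v_val f 0 fk f0.
Qed.

End Specialization.

(** * Finite and algebraically closed fields *)

(** A constant nonzero derivative makes [H] separable, so [H] has deg H distinct roots, too many to
    be all roots of [q]. *)
Lemma separable_nonroot (K : closedFieldType) (H q : {poly K}) (c : K) :
  H^`() = c%:P -> c != 0 -> q != 0 -> (size q < size H)%N ->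
  exists2 be, root H be & q.[be] != 0.
Proof.
move=> dH c0 q0 sq.
have H0 : H != 0 by rewrite -size_poly_gt0; apply: leq_ltn_trans sq.
have [rs eH] := closed_field_poly_normal H.
have l0 : lead_coef H != 0 by rewrite lead_coef_eq0.
have sH : size H = (size rs).+1 by rewrite eH size_scale // size_prod_XsubC.
have urs : uniq rs.
  rewrite -separable_prod_XsubC; have : separable_poly H.
    rewrite unlock dH; apply/coprimepP => d _.
    have c1 : c%:P %= 1 by rewrite polyC_eqp1.
    by rewrite (eqp_dvdr _ c1) dvdp1 size_poly_eq1.
  by rewrite eH (eqp_separable (eqp_scale _ l0)).
apply: contrapT => no; suff : (size rs < size q)%N by rewrite ltnNge -ltnS -sH sq.
apply: max_poly_roots => //; apply/allP => be bers; apply: contrapT => nr.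
apply: no; exists be; last by apply/negP.
by rewrite eH rootZ // root_prod_XsubC.
Qed.

Lemma pnat_fmorph (F : fieldType) (R : nzRingType) (iota : {rmorphism F -> R}) m :
  [pchar F].-nat m -> [pchar R].-nat m.
Proof. by rewrite (eq_pnat _ (fmorph_pchar iota)). Qed.

Section Frobenius.

Variables (F : finFieldType) (F_char : [pchar F].-nat #|F|).

Lemma expf_card_pow d (c : F) : c ^+ (#|F| ^ d) = c.
Proof. by elim: d => [|d IH]; rewrite ?expr1 // expnSr exprM IH expf_card. Qed.

Lemma horner_frobenius (R : comNzRingType) (iota : {rmorphism F -> R}) d p w :
  (map_poly iota p).[w] ^+ (#|F| ^ d) = (map_poly iota p).[w ^+ (#|F| ^ d)].
Proof.
have chR : [pchar R].-nat (#|F| ^ d)%N by rewrite (pnat_fmorph iota) // pnatX F_char.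
elim/poly_ind: p => [|p c IH].
  by rewrite rmorph0 !horner0 expr0n expn_eq0 -leqn0 leqNgt (ltnW (card_finNzRing_gt1 _)).
rewrite rmorphD rmorphM /= map_polyX map_polyC /= !hornerMXaddC exprDn_pchar //.
by rewrite exprMn IH -rmorphXn expf_card_pow.
Qed.

Lemma frobenius_inj (R : idomainType) (iota : {rmorphism F -> R}) d :
  injective (fun w : R => w ^+ (#|F| ^ d)).
Proof.
have chR : [pchar R].-nat (#|F| ^ d)%N by rewrite (pnat_fmorph iota) // pnatX F_char.
move=> v w /= e; have := exprDn_pchar (v - w) w chR; rewrite subrK e.
by rewrite -[LHS]add0r => /addIr/esym/eqP; rewrite expf_eq0 subr_eq0 => /andP[_ /eqP].
Qed.

(** The iterates of [w] under the Frobenius map are roots of one polynomial over F, so two of them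
    agree by the pigeonhole principle; injectivity of the map cancels the smaller exponent. *)
Lemma frobenius_periodic (K : fieldType) (jota : {rmorphism F -> K}) :
  integralRange jota -> forall w : K, exists2 d, (0 < d)%N & w ^+ (#|F| ^ d) = w.
Proof.
move=> intK w; have [p mp rp] := intK w.
pose s := mkseq (fun i => w ^+ (#|F| ^ i)) (size p).
have p0 : map_poly jota p != 0 by apply/monic_neq0/monic_map.
have : ~~ uniq s.
  apply/negP => us; suff : (size s < size (map_poly jota p))%N.
    by rewrite size_mkseq size_map_poly ltnn.
  apply: max_poly_roots => //; apply/allP => _ /mapP[i _ ->].
  by rewrite rootE -horner_frobenius (rootP rp) expr0n expn_eq0 -leqn0 leqNgt
    (ltnW (card_finNzRing_gt1 _)).
case/(uniqPn 0) => i [j [ij]]; rewrite size_mkseq => js.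
rewrite !nth_mkseq ?(ltn_trans ij js) // => e.
exists (j - i)%N; first by rewrite subn_gt0.
apply: (@frobenius_inj K jota i); rewrite /= -exprM -expnD subnK ?(ltnW ij) //.
Qed.

End Frobenius.

Lemma min_poly_exists (F K : fieldType) (jota : {rmorphism F -> K})
    (D : {poly F}) (ze : K) :
  D != 0 -> root (map_poly jota D) ze ->
  exists pi : {poly F}, [/\ pi != 0, (1 < size pi)%N, root (map_poly jota pi) ze
    & forall p, root (map_poly jota p) ze -> pi %| p].
Proof.
move=> D0 rD.
pose Q m := `[< exists p : {poly F}, [/\ p != 0, root (map_poly jota p) ze & size p = m] >].
have ex : exists m, Q m by exists (size D); apply/asboolP; exists D.
case: (ex_minnP ex) => m /asboolP[pi [pi0 rpi <-]] pmin.
exists pi; split=> // [|p rp].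
  by rewrite -(size_map_poly jota); apply: root_size_gt1 rpi; rewrite map_poly_eq0.
apply/modp_eq0P/eqP/negPn/negP => m0.
have : Q (size (p %% pi)).
  apply/asboolP; exists (p %% pi); split=> //.
  have := divp_eq p pi => /(congr1 (map_poly jota)); rewrite rmorphD rmorphM /= => e.
  move: rp; rewrite e !rootE hornerD hornerM.
  by rewrite (rootP rpi) mulr0 add0r.
by move/pmin; rewrite leqNgt ltn_modp pi0.
Qed.

(** * The affine coordinate ring *)

Section GKRing.

Variables (n : nat) (n_ge2 : (2 <= n)%N) (F : fieldType).

Section Ring.

Variables (R : comNzRingType) (iota : {rmorphism F -> R}) (X Y Z : R).

Definition gk_relations :=
  X ^+ n + X = Y ^+ n.+1 /\ Z ^+ (n ^ 2 - n + 1)%N = Y ^+ (n ^ 2)%N - Y.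

Definition gk_elt (g : 'I_n -> 'I_(n ^ 2) -> {poly F}) : R :=
  \sum_(i < n) (\sum_(j < n ^ 2) (map_poly iota (g i j)).[Z] * Y ^+ j) * X ^+ i.

(** The tower F[Z], F[Z][Y], F[Z][Y][X] is described by spans over an arbitrary commutative ring,
    because it is used both in the field L and in a product L * K, which is not a domain. *)
Definition gk_ring : R -> Prop :=
  pow_span (pow_span (poly_val iota Z) Y (n ^ 2)%N) X n.

Lemma gk_ringP r : gk_ring r <-> exists g, r = gk_elt g.
Proof.
split=> [[s Hs ->]|[g ->]].
  have /choice[g gP] i : exists g : 'I_(n ^ 2) -> {poly F},
      s i = \sum_(j < n ^ 2) (map_poly iota (g j)).[Z] * Y ^+ j.
    have [c /choice[g gP] ->] := Hs i; exists g.
    by apply: eq_bigr => j _; rewrite gP.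
  by exists g; apply: eq_bigr => i _; rewrite gP.
exists (fun i => \sum_(j < n ^ 2) (map_poly iota (g i j)).[Z] * Y ^+ j) => // i.
by exists (fun j => (map_poly iota (g i j)).[Z]) => // j; exists (g i j).
Qed.

Lemma gk_ring_min (C : R -> Prop) : subring C -> (forall c, C (iota c)) ->
  C X -> C Y -> C Z -> forall r, gk_ring r -> C r.
Proof.
move=> sC Cc CX CY CZ; apply: pow_span_min => //; apply: pow_span_min => //.
exact: poly_val_min.
Qed.

Let n2_gt0 : (0 < n ^ 2)%N. Proof. by rewrite expn_gt0 (ltnW n_ge2). Qed.
Let n_gt0 : (0 < n)%N. Proof. exact: ltnW. Qed.

Hypothesis rels : gk_relations.

Let S1 := poly_val iota Z.
Let S2 := pow_span S1 Y (n ^ 2)%N.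

Lemma gk_mid_subring : subring S2.
Proof.
apply: pow_span_subring => //; first exact: poly_val_subring.
have -> : Y ^+ (n ^ 2)%N = Y ^+ 1 + Z ^+ (n ^ 2 - n + 1)%N.
  by case: rels => _ ->; rewrite expr1 subrKC.
apply: pow_spanD; [exact: poly_val_subring| |].
  apply: pow_span_gen; first exact: poly_val_subring.
  by rewrite (@leq_trans n) // leq_pmulr.
apply: pow_span_sub => //; first exact: poly_val_subring.
by apply: subringX; [exact: poly_val_subring|exact: poly_val_mem].
Qed.

Lemma gk_mid_Y : S2 Y.
Proof.
rewrite -[Y]expr1; apply: pow_span_gen; first exact: poly_val_subring.
by rewrite (@leq_trans n) // leq_pmulr.
Qed.

Lemma gk_ring_subring : subring gk_ring.
Proof.
apply: pow_span_subring => //; first exact: gk_mid_subring.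
have -> : X ^+ n = Y ^+ n.+1 + iota (-1) * X ^+ 1.
  by case: rels => <- _; rewrite rmorphN rmorph1 expr1 mulN1r addrK.
apply: pow_spanD; first exact: gk_mid_subring.
  apply: pow_span_sub => //; first exact: gk_mid_subring.
  by apply: subringX; [exact: gk_mid_subring|exact: gk_mid_Y].
apply: pow_span_scale; first exact: gk_mid_subring.
  apply: pow_span_sub => //; first exact: poly_val_subring.
  exact: poly_val_const.
by apply: pow_span_gen => //; exact: gk_mid_subring.
Qed.

Lemma gk_ring_poly p : gk_ring (map_poly iota p).[Z].
Proof.
apply: pow_span_sub => //; first exact: gk_mid_subring.
apply: pow_span_sub => //; first exact: poly_val_subring.
by exists p.
Qed.

Lemma gk_ring_const c : gk_ring (iota c).
Proof. by have := gk_ring_poly c%:P; rewrite map_polyC hornerC. Qed.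

Lemma gk_ring_Z : gk_ring Z.
Proof. by have := gk_ring_poly 'X; rewrite map_polyX hornerX. Qed.

Lemma gk_ring_Y : gk_ring Y.
Proof. by apply: pow_span_sub => //; [exact: gk_mid_subring|exact: gk_mid_Y]. Qed.

Lemma gk_ring_X : gk_ring X.
Proof.
rewrite -[X]expr1; apply: pow_span_gen => //; exact: gk_mid_subring.
Qed.

Lemma gk_ringN r : gk_ring r -> gk_ring (- r).
Proof.
rewrite -mulN1r -(rmorph1 iota) -rmorphN => gr.
by case: gk_ring_subring => _ _ _; apply=> //; apply: gk_ring_const.
Qed.

End Ring.

(** For the two projections of L * K: a single normal form then yields a function together with its
    value at a point. *)
Lemma gk_elt_morph (R R' : comNzRingType) (iota : {rmorphism F -> R})
    (iota' : {rmorphism F -> R'}) (phi : {rmorphism R -> R'}) X Y Z g :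
  (forall c, phi (iota c) = iota' c) ->
  phi (gk_elt iota X Y Z g) = gk_elt iota' (phi X) (phi Y) (phi Z) g.
Proof.
move=> phiE; rewrite rmorph_sum; apply: eq_bigr => i _.
rewrite rmorphM rmorphXn; congr (_ * _); rewrite rmorph_sum.
apply: eq_bigr => j _; rewrite rmorphM rmorphXn; congr (_ * _).
rewrite -horner_map -map_poly_comp; congr (_.[_]).
by apply: eq_map_poly => c; apply: phiE.
Qed.

End GKRing.

Section PairMorphism.

Variables (F : pzRingType) (R S : pzRingType).
Variables (iota : {rmorphism F -> R}) (jota : {rmorphism F -> S}).

Definition pair_morph (c : F) : R * S := (iota c, jota c).

Fact pair_morph_zmod : zmod_morphism pair_morph.
Proof. by move=> c d; rewrite /pair_morph !rmorphB. Qed.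

Fact pair_morph_monoid : monoid_morphism pair_morph.
Proof. by split=> [|c d]; rewrite /pair_morph ?rmorph1 ?rmorphM. Qed.

HB.instance Definition _ := GRing.isZmodMorphism.Build F (R * S)%type pair_morph
  pair_morph_zmod.
HB.instance Definition _ := GRing.isMonoidMorphism.Build F (R * S)%type pair_morph
  pair_morph_monoid.

End PairMorphism.

Lemma pairX (R S : pzRingType) (r : R) (s : S) m :
  (r, s) ^+ m = (r ^+ m, s ^+ m).
Proof. by elim: m => [//|m IH]; rewrite !exprS IH. Qed.

Lemma exprB_pchar (R : comNzRingType) (r s : R) m : (0 < m)%N ->
  [pchar R].-nat m -> (r - s) ^+ m = r ^+ m - s ^+ m.
Proof.
move=> m0 chm; have := exprDn_pchar (r - s) s chm; rewrite subrK => ->.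
by rewrite addrK.
Qed.

Lemma pnat_natr0 (R : nzSemiRingType) m : (1 < m)%N -> [pchar R].-nat m ->
  m%:R = 0 :> R.
Proof.
move=> m1 /(pnatP _ (ltnW m1)) h; have [p prp dp] := pdivP m1.
by apply/eqP; rewrite -(dvdn_pcharf (h p prp dp)).
Qed.

Definition poly_eval (F : nzRingType) (R : comNzRingType) (iota : {rmorphism F -> R})
  (w : R) : {rmorphism {poly F} -> R} := horner_eval w \o map_poly iota.

Lemma poly_evalE (F : nzRingType) (R : comNzRingType) (iota : {rmorphism F -> R}) w p :
  poly_eval iota w p = (map_poly iota p).[w].
Proof. by []. Qed.

Lemma integral_trinomial (R : comNzRingType) (K : fieldType) (f : {rmorphism R -> K})
    (w e c : K) m : (1 < m)%N -> w ^+ m + e * w = c ->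
  integralOver f c -> integralOver f e -> integralOver f w.
Proof.
move=> m1 wc ci ei; pose q := 'X^m + (e *: 'X - c%:P).
have sq : (size (e *: 'X - c%:P)%R < m.+1)%N.
  apply: leq_ltn_trans (size_polyD _ _) _; rewrite size_polyN gtn_max.
  rewrite (leq_ltn_trans (size_polyC_leq1 _)) ?(leq_trans m1) // andbT.
  by rewrite (leq_ltn_trans (size_scale_leq _ _)) // size_polyX.
apply: (@integral_root_monic _ _ _ _ q).
- by rewrite monicE lead_coefDl ?lead_coefXn // size_polyXn.
- by rewrite rootE !hornerE /= wc subrr.
- apply/integral_poly => i; rewrite !coefE.
  apply: integral_add; first exact: integral_nat.
  apply: integral_add; first by apply: integral_mul => //; apply: integral_nat.
  by apply: integral_opp; case: ifP => // _; apply: integral0.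
Qed.

(** * Places centered at affine points *)

Section Points.

Variables (n : nat) (n_ge2 : (2 <= n)%N) (F : finFieldType).
Hypothesis n_char : [pchar F].-nat n.
Hypothesis F_char : [pchar F].-nat #|F|.

Variables (L : fieldType) (iota : {rmorphism F -> L}) (x y z : L).
Hypothesis L_rels : gk_relations n x y z.
Hypothesis L_free : forall g, gk_elt iota x y z g = 0 ->
  forall (i : 'I_n) (j : 'I_(n ^ 2)), g i j = 0.
Hypothesis L_frac : forall f, exists g h,
  [/\ gk_ring n iota x y z g, gk_ring n iota x y z h, h != 0 & f = g / h].

Local Notation A := (gk_ring n iota x y z).
Local Notation ev := (poly_eval iota z).

Let n2_gt1 : (1 < n ^ 2)%N.
Proof. by rewrite (@leq_trans n) // leq_pmulr // ltnW. Qed.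

(** p(z) is the normal form whose only coefficient is [p], in position (0, 0). *)
Lemma poly_eval_inj p : ev p = 0 -> p = 0.
Proof.
move=> p0; have n0 : (0 < n)%N by apply: ltnW.
pose g (i : 'I_n) (j : 'I_(n ^ 2)) := if (i == 0 :> nat) && (j == 0 :> nat) then p else 0.
have := @L_free g _ (Ordinal n0) (Ordinal (ltnW n2_gt1)); apply.
rewrite /gk_elt (bigD1 (Ordinal n0)) //= [X in _ + X]big1 ?addr0 => [|i].
  rewrite (bigD1 (Ordinal (ltnW n2_gt1))) //= [X in _ + X]big1 ?addr0 => [|j].
    by rewrite /g /= -poly_evalE p0 !mul0r.
  by rewrite -val_eqE /g /= => /negPf ->; rewrite rmorph0 horner0 mul0r.
rewrite -val_eqE /g /= => /negPf ->; rewrite big1 ?mul0r // => j _.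
by rewrite rmorph0 horner0 mul0r.
Qed.

Lemma gk_ring_eval p : A (ev p).
Proof. exact: gk_ring_poly. Qed.

Lemma gk_ring_integral l : A l -> integralOver ev l.
Proof.
move: l; have ev_int p : integralOver ev (ev p) by apply: integral_id.
have z_int : integralOver ev z by have := ev_int 'X; rewrite poly_evalE map_polyX hornerX.
have y_int : integralOver ev y.
  case: L_rels => _ ez; apply: (integral_trinomial (m := n ^ 2) (e := -1)) n2_gt1 _ _ _.
  + by rewrite mulN1r; apply/esym/ez.
  + exact: subringX (integral_subring ev) z_int.
  + by apply: integral_opp; apply: integral1.
apply: gk_ring_min => //; first exact: integral_subring.
- by move=> c; have := ev_int c%:P; rewrite poly_evalE map_polyC hornerC.
- case: L_rels => ex _; apply: (@integral_trinomial _ _ ev x 1 (y ^+ n.+1) n) => //.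
  + by rewrite mul1r; rewrite ex.
  + exact: subringX (integral_subring ev) y_int.
  + exact: integral1.
Qed.

Section Point.

Variables (K : fieldType) (jota : {rmorphism F -> K}) (al be ze : K).
Hypothesis K_rels : gk_relations n al be ze.
Variable d : nat.
Hypothesis d_gt0 : (0 < d)%N.
Local Notation N := (#|F| ^ d)%N.
Hypotheses (al_N : al ^+ N = al) (be_N : be ^+ N = be) (ze_N : ze ^+ N = ze).

(* Normal forms computed in the product ring L * K are valid in L and at the
   point (al, be, ze) simultaneously; as they are unique in L, the value of a
   function at the point is well defined. *)
Let pt : {rmorphism F -> (L * K)%type} := pair_morph iota jota.
Let AK : (L * K)%type -> Prop := gk_ring n pt (x, al) (y, be) (z, ze).
Definition specializes (l : L) (ka : K) := AK (l, ka).
Local Notation B := specializes.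
Local Notation val := (has_value B).

Lemma pair_rels : gk_relations n (x, al) (y, be) (z, ze).
Proof.
case: L_rels K_rels => e1 e2 [e3 e4].
split; rewrite !pairX; first by congr pair.
by rewrite e2 e4.
Qed.

Lemma AK_subring : subring AK.
Proof. exact: gk_ring_subring pair_rels. Qed.

Lemma specializesP l ka : B l ka <-> exists g : 'I_n -> 'I_(n ^ 2) -> {poly F},
  l = gk_elt iota x y z g /\ ka = gk_elt jota al be ze g.
Proof.
have fstE (g : 'I_n -> 'I_(n ^ 2) -> {poly F}) :
    (gk_elt pt (x, al) (y, be) (z, ze) g).1 = gk_elt iota x y z g.
  exact: (@gk_elt_morph n F _ _ pt iota fst (x, al) (y, be) (z, ze) g (fun=> erefl)).
have sndE (g : 'I_n -> 'I_(n ^ 2) -> {poly F}) :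
    (gk_elt pt (x, al) (y, be) (z, ze) g).2 = gk_elt jota al be ze g.
  exact: (@gk_elt_morph n F _ _ pt jota snd (x, al) (y, be) (z, ze) g (fun=> erefl)).
split=> [/gk_ringP[g e]|[g [-> ->]]].
  by exists g; rewrite -fstE -sndE -e.
by apply/gk_ringP; exists g; rewrite -fstE -sndE -surjective_pairing.
Qed.

Lemma specializes_const c : B (iota c) (jota c).
Proof. exact: (@gk_ring_const n n_ge2 F _ pt _ _ _ pair_rels c). Qed.

Lemma specializesD g h ga et : B g ga -> B h et -> B (g + h) (ga + et).
Proof. by case: AK_subring => _ _ AD _ Bg Bh; apply: (AD _ _ Bg Bh). Qed.

Lemma specializesM g h ga et : B g ga -> B h et -> B (g * h) (ga * et).
Proof. by case: AK_subring => _ _ _ AM Bg Bh; apply: (AM _ _ Bg Bh). Qed.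

Lemma specializes0 ga : B 0 ga -> ga = 0.
Proof.
move/specializesP=> [g [/esym/L_free g0 ->]].
rewrite /gk_elt big1 // => i _; rewrite big1 ?mul0r // => j _.
by rewrite g0 rmorph0 horner0 mul0r.
Qed.

Lemma specializes_ev p : B (ev p) (poly_eval jota ze p).
Proof.
have := @gk_ring_poly n n_ge2 F _ pt _ _ _ pair_rels p.
suff -> : (map_poly pt p).[(z, ze)] = (ev p, poly_eval jota ze p) by [].
have E1 : (map_poly pt p).[(z, ze)].1 = ev p.
  by rewrite -[LHS](horner_map fst) -map_poly_comp.
have E2 : (map_poly pt p).[(z, ze)].2 = poly_eval jota ze p.
  by rewrite -[LHS](horner_map snd) -map_poly_comp.
by rewrite -E1 -E2 -surjective_pairing.
Qed.

Lemma gk_ring_specializes l : A l -> exists ka, B l ka.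
Proof.
move/gk_ringP=> [g ->]; exists (gk_elt jota al be ze g).
by apply/specializesP; exists g.
Qed.

Let N_gt1 : (1 < N)%N.
Proof. by rewrite -(exp1n d) ltn_exp2r // card_finNzRing_gt1. Qed.

Let t := ev ('X^N - 'X).

Let tE : t = z ^+ N - z.
Proof. by rewrite /t poly_evalE rmorphB /= map_polyXn map_polyX !hornerE. Qed.

Let t_neq0 : t != 0.
Proof.
apply/eqP => /poly_eval_inj/eqP; apply/negP; rewrite -size_poly_gt0.
by rewrite size_polyDl ?size_polyN ?size_polyXn ?size_polyX.
Qed.

Let Bt : B t 0.
Proof.
have := specializes_ev ('X^N - 'X); congr (B _ _).
by rewrite poly_evalE rmorphB /= map_polyXn map_polyX !hornerE /= ze_N subrr.
Qed.

Let inI f := exists f' ka, val f' ka /\ f = t * f'.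

Let valD := has_valueD specializesD specializesM specializes0.
Let valM := has_valueM specializesM.
Let valV := @has_valueV _ _ B.
Let val_sub := has_value_sub specializes_const.
Let valX := has_valueX specializes_const specializesM.
Let valN := has_valueN specializes_const specializesM.
Let val_const := has_value_const specializes_const.

Let inI0 : inI 0.
Proof.
exists 0, 0; rewrite mulr0; split=> //; apply: val_sub.
by case: AK_subring.
Qed.

Let inID f g : inI f -> inI g -> inI (f + g).
Proof.
move=> [f' [a [fa ->]]] [g' [b [gb ->]]]; exists (f' + g'), (a + b).
by rewrite mulrDr; split=> //; apply: valD.
Qed.

Let inIM f g ka : inI f -> val g ka -> inI (f * g).
Proof.
move=> [f' [a [fa ->]]] gk; exists (f' * g), (a * ka).
by rewrite mulrA; split=> //; apply: valM.
Qed.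

Let inI_cancel w u ka : val u ka -> ka != 0 -> inI (w * u) -> inI w.
Proof.
move=> uk k0 wu.
have u0 : u != 0 by apply: (value_unit_neq0 specializes0); exists ka.
by rewrite -[w](mulfK u0); apply: inIM wu (valV uk k0).
Qed.

Let L_char_N : [pchar L].-nat N.
Proof. by rewrite (pnat_fmorph iota) // pnatX F_char. Qed.

(* t = z^N - z is a uniformizer: the l with l^N - l in t O form a ring that
   contains x, y, z, and g^N - g = g (g^(N-1) - 1) where the second factor is a
   unit when g vanishes at the point. *)
Let frob_ideal (r : (L * K)%type) := AK r /\ inI (r.1 ^+ N - r.1).

Let frob_ideal_subring : subring frob_ideal.
Proof.
have N0 : (0 < N)%N by apply: ltnW.
have [A0 A1 AD AM] := AK_subring; split.
- by split=> //=; rewrite expr0n gtn_eqF // subr0.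
- by split=> //=; rewrite expr1n subrr.
- move=> [l1 k1] [l2 k2] [/= B1 I1] [/= B2 I2]; split; first exact: AD.
  by rewrite /= exprDn_pchar // opprD addrACA; apply: inID.
- move=> [l1 k1] [l2 k2] [/= B1 I1] [/= B2 I2]; split; first exact: AM.
  rewrite /= exprMn.
  have -> : l1 ^+ N * l2 ^+ N - l1 * l2 =
      (l1 ^+ N - l1) * l2 ^+ N + (l2 ^+ N - l2) * l1 by ring.
  apply: inID; apply: inIM => //; last exact: val_sub B1.
  exact/valX/val_sub/B2.
Qed.

(** The difference v = w^N - w vanishes at the point, so in v^m + e v = v (v^(m-1) + e) the second
    factor has residue [e], a nonzero constant, and can be cancelled. This is where unramifiedness
    enters: [e] is the derivative of the equation of y over F[z], or of x over F[z, y]. *)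
Let frob_diff (w : L) om m : (1 < m)%N -> B w om -> om ^+ N = om ->
  forall e : L, e != 0 -> forall c, e = iota c ->
  inI ((w ^+ N - w) ^+ m + e * (w ^+ N - w)) -> inI (w ^+ N - w).
Proof.
move=> m1 Bw omN e e0 c ec; set v := w ^+ N - w => vI.
have vv : val v 0.
  rewrite -(subrr om) -{1}omN; apply: valD; last exact/valN/val_sub.
  exact/valX/val_sub.
have mE : m = m.-1.+1 by rewrite prednK // ltnW.
apply: (@inI_cancel v (v ^+ m.-1 + e) (0 ^+ m.-1 + jota c)).
- by apply: valD; [exact: valX|rewrite ec; exact: val_const].
- have m0 : (0 < m.-1)%N by rewrite -subn1 subn_gt0.
  by rewrite expr0n gtn_eqF // add0r fmorph_eq0 -(fmorph_eq0 iota) -ec.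
- by rewrite mulrDr -exprS -mE [v * e]mulrC.
Qed.

Let frob_ideal_all r : AK r -> frob_ideal r.
Proof.
have N0 : (0 < N)%N by apply: ltnW.
case: frob_ideal_subring (L_rels) => _ _ _ _ [ex ez].
have fz : frob_ideal (z, ze).
  split; first exact: gk_ring_Z pair_rels.
  exists 1, 1; rewrite mulr1 -tE; split=> //.
  by rewrite -(rmorph1 iota) -(rmorph1 jota); apply: val_const.
have n2_char : [pchar L].-nat (n ^ 2)%N by rewrite (pnat_fmorph iota) // pnatX n_char.
have nL_char : [pchar L].-nat n by rewrite (pnat_fmorph iota).
have By : AK (y, be) by exact: gk_ring_Y pair_rels.
have Bx : AK (x, al) by exact: gk_ring_X pair_rels.
have fy : frob_ideal (y, be).
  split=> //; apply: (@frob_diff y be (n ^ 2)%N n2_gt1 By be_N (-1) _ (-1)).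
  - by rewrite oppr_eq0 oner_eq0.
  - by rewrite rmorphN1.
  rewrite mulN1r exprB_pchar ?(ltnW n2_gt1) // -exprM [(N * _)%N]mulnC exprM.
  (* All powers involved are additive, so this is the N-th power of the equation of y minus the
     equation itself. *)
  have -> : (y ^+ (n ^ 2)%N) ^+ N - y ^+ (n ^ 2)%N - (y ^+ N - y) =
      (z ^+ (n ^ 2 - n + 1)%N) ^+ N - z ^+ (n ^ 2 - n + 1)%N.
    by rewrite ez exprB_pchar //; ring.
  have [_] := subringX (n ^ 2 - n + 1)%N frob_ideal_subring fz.
  by rewrite pairX.
have fx : frob_ideal (x, al).
  split=> //; apply: (@frob_diff x al n n_ge2 Bx al_N 1 _ 1).
  - by rewrite oner_eq0.
  - by rewrite rmorph1.
  rewrite mul1r exprB_pchar ?(ltnW n_ge2) // -exprM [(N * _)%N]mulnC exprM.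
  have -> : (x ^+ n) ^+ N - x ^+ n + (x ^+ N - x) = (y ^+ n.+1) ^+ N - y ^+ n.+1.
    by rewrite -ex exprDn_pchar //; ring.
  have [_] := subringX n.+1 frob_ideal_subring fy.
  by rewrite pairX.
apply: (@gk_ring_min n F _ pt _ _ _ frob_ideal) => //.
move=> c; split; first exact: specializes_const.
rewrite /= -rmorphXn expf_card_pow subrr; exact: inI0.
Qed.

Let uniformizer g : B g 0 -> inI g.
Proof.
move=> Bg; have [_ /= gI] := frob_ideal_all Bg.
have N0 : (0 < N.-1)%N by rewrite -subn1 subn_gt0.
apply: (@inI_cancel g (g ^+ N.-1 - 1) (0 ^+ N.-1 - 1)).
- apply: valD; first exact/valX/val_sub.
  by rewrite -(rmorph1 iota) -(rmorph1 jota); apply/valN/val_const.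
- by rewrite expr0n gtn_eqF // sub0r oppr_eq0 oner_eq0.
- by rewrite mulrBr mulr1 -exprS prednK // ltnW.
Qed.

(* Each division by t costs D a nonconstant common factor with X^N - X. *)
Let ev_bounded D : D != 0 -> forall e f ka, val f ka -> ev D = t ^+ e * f ->
  (e <= size D)%N.
Proof.
have [s] := ubnP (size D); elim: s D => // s IH D sD D0 [//|e] f ka fk De.
have rD : root (map_poly jota D) ze.
  rewrite rootE -poly_evalE; apply/eqP.
  apply: (has_value_uniq specializes_const specializesD specializesM specializes0
    (f := ev D)); first exact/val_sub/specializes_ev.
  rewrite De -[0](mul0r ka); apply: valM => //.
  by rewrite -[X in val _ X](expr0n _ e.+1); apply/valX/val_sub.
pose T : {poly F} := 'X^N - 'X; pose G := gcdp D T.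
have rG : root (map_poly jota G) ze.
  rewrite gcdp_map root_gcd rD rootE rmorphB /= map_polyXn map_polyX !hornerE /=.
  by rewrite ze_N subrr.
have /dvdpP[D1 eD] : G %| D by apply: dvdp_gcdl.
have /dvdpP[T1 eT] : G %| T by apply: dvdp_gcdr.
have G0 : G != 0 by rewrite gcdp_eq0 negb_and D0.
have sG : (1 < size G)%N.
  by rewrite -(size_map_poly jota); apply: root_size_gt1 rG; rewrite map_poly_eq0.
have D10 : D1 != 0 by apply: contraNneq D0 => D10; rewrite eD D10 mul0r.
have sD1 : (size D1 < size D)%N.
  rewrite eD size_mul // -subn1 -addnBA ?(ltnW sG) // -[X in (X < _)%N]addn0 ltn_add2l.
  by rewrite subn_gt0.
apply: leq_ltn_trans (sD1).
apply: (IH D1 _ D10 _ (ev T1 * f) (poly_eval jota ze T1 * ka)).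
- exact: leq_trans sD1 sD.
- by apply: valM => //; apply/val_sub/specializes_ev.
have evG : ev G != 0 by apply: contraNneq G0 => /poly_eval_inj ->.
apply: (mulIf evG); rewrite -rmorphM -eD De exprSr.
by rewrite {2}/t -/T eT rmorphM /=; ring.
Qed.

Lemma point_place : exists P : place iota,
  [/\ forall l ka, B l ka -> l != 0 -> 0 <= P l,
      forall l ka, B l ka -> ka != 0 -> P l = 0
    & forall l, B l 0 -> l != 0 -> 0 < P l].
Proof.
have [||f|P [P1 P2 P3]] := @specialization_place F L K iota jota B specializes_const
    specializesD specializesM specializes0 t t_neq0 Bt.
- exact: uniformizer.
- move=> g ga Bg g0.
  have Ag : A g by move/specializesP: Bg => [g' [-> _]]; apply/gk_ringP; exists g'.
  (* Divisibility of [g] by powers of [t] is bounded through a multiple g h = D(z), which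
     integrality over F[z] provides. *)
  have [h [D [Ah gh evD]]] := integral_divides (gk_ring_subring n_ge2 iota L_rels)
    (fun p => gk_ringN n_ge2 L_rels (gk_ring_eval p)) Ag g0 (gk_ring_integral Ag).
  exists (size D) => e f ka fk ge; have [et Bh] := gk_ring_specializes Ah.
  apply: (@ev_bounded D _ e (f * h) (ka * et)).
  + by apply: contraNneq evD => ->; rewrite rmorph0.
  + by apply: valM => //; apply: val_sub.
  + by rewrite -gh ge mulrA.
- have [g [h [Ag Ah h0 ->]]] := L_frac f.
  have [ga Bg] := gk_ring_specializes Ag; have [et Bh] := gk_ring_specializes Ah.
  by exists g, ga, h, et.
exists P; split.
- by move=> l ka /val_sub; apply: P1.
- by move=> l ka /val_sub; apply: P2.
- by move=> l /val_sub; apply: P3.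
Qed.

End Point.

End Points.

Lemma size_trinomial (K : fieldType) m (e c : K) : (1 < m)%N ->
  size ('X^m + (e *: 'X - c%:P) : {poly K}) = m.+1.
Proof.
move=> m1; rewrite size_polyDl size_polyXn //.
apply: leq_ltn_trans (size_polyD _ _) _; rewrite size_polyN gtn_max.
rewrite (leq_ltn_trans (size_polyC_leq1 _)) ?(leq_trans m1) // andbT.
by rewrite (leq_ltn_trans (size_scale_leq _ _)) // size_polyX.
Qed.

Lemma deriv_trinomial (K : fieldType) m (e c : K) : m%:R = 0 :> K ->
  ('X^m + (e *: 'X - c%:P) : {poly K})^`() = e%:P.
Proof.
move=> m0; rewrite derivD derivXn derivB derivZ derivX derivC subr0 alg_polyC.
by rewrite -scaler_nat m0 scale0r add0r.
Qed.

(** The point is lifted from z to y and then to x. The fibres have n^2 and n distinct elements, more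
    than the degree of the polynomial in Y, respectively X, that has to be kept nonzero. *)
Lemma gk_point_above (n : nat) (n_ge2 : (2 <= n)%N) (F : fieldType) (K : closedFieldType)
    (jota : {rmorphism F -> K}) (K_char : [pchar K].-nat n)
    (g : 'I_n -> 'I_(n ^ 2) -> {poly F}) (ze : K) i0 j0 :
  ~~ root (map_poly jota (g i0 j0)) ze ->
  exists al be, gk_relations n al be ze /\ gk_elt jota al be ze g != 0.
Proof.
move=> nr.
have n2_gt1 : (1 < n ^ 2)%N by rewrite (@leq_trans n) // leq_pmulr // ltnW.
have nK : n%:R = 0 :> K by apply: pnat_natr0.
have n2K : (n ^ 2)%:R = 0 :> K by rewrite natrX nK expr0n.
(* [insub] turns the ordinal-indexed family into natural-indexed coefficients; the default 0 lies
   outside the range of [\poly]. *)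
pose q i := \poly_(j < n ^ 2) oapp (fun j => (map_poly jota (g i j)).[ze]) 0 (insub j).
have qE i w : (q i).[w] = \sum_(j < n ^ 2) (map_poly jota (g i j)).[ze] * w ^+ j.
  by rewrite horner_poly; apply: eq_bigr => j _; rewrite valK.
have q0 : q i0 != 0.
  apply: contraNneq nr => q0; rewrite rootE; apply/eqP.
  by have := coef_poly (n ^ 2) (fun j => oapp (fun j => (map_poly jota (g i0 j)).[ze]) 0
    (insub j)) j0;
    rewrite -/(q i0) q0 coef0 ltn_ord valK.
have N10 : (-1 : K) != 0 by rewrite oppr_eq0 oner_eq0.
have [|be rbe qbe] := separable_nonroot
  (deriv_trinomial (-1) (ze ^+ (n ^ 2 - n + 1)%N) n2K) N10 q0.
  by rewrite size_trinomial // ltnS size_poly.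
pose r := \poly_(i < n) oapp (fun i => (q i).[be]) 0 (insub i).
have rE w : r.[w] = \sum_(i < n) (q i).[be] * w ^+ i.
  by rewrite horner_poly; apply: eq_bigr => i _; rewrite valK.
have r0 : r != 0.
  apply: contraNneq qbe => r0; apply/eqP.
  by have := coef_poly n (fun i => oapp (fun i => (q i).[be]) 0 (insub i)) i0;
    rewrite -/r r0 coef0 ltn_ord valK.
have [|al ral ral0] := separable_nonroot
  (deriv_trinomial 1 (be ^+ n.+1) nK) (oner_neq0 K) r0.
  by rewrite size_trinomial // ltnS size_poly.
exists al, be; split; last first.
  rewrite rE in ral0; congr (_ != 0) : ral0.
  by apply: eq_bigr => i _; rewrite qE.
move: rbe ral; rewrite !rootE !hornerE /= !subr_eq0 => /eqP e1 /eqP e2.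
by split; [rewrite -e2 ?mul1r|rewrite -e1 ?mulN1r].
Qed.

(** * Regular functions *)

Section RegularAffine.

Variables (n : nat) (n_ge2 : (2 <= n)%N) (F : finFieldType).
Hypothesis n_char : [pchar F].-nat n.
Hypothesis F_char : [pchar F].-nat #|F|.

Variables (L : fieldType) (iota : {rmorphism F -> L}) (x y z : L).
Hypothesis L_rels : gk_relations n x y z.
Hypothesis L_free : forall g, gk_elt iota x y z g = 0 ->
  forall (i : 'I_n) (j : 'I_(n ^ 2)), g i j = 0.
Hypothesis L_frac : forall f, exists g h,
  [/\ gk_ring n iota x y z g, gk_ring n iota x y z h, h != 0 & f = g / h].

Local Notation A := (gk_ring n iota x y z).
Local Notation ev := (poly_eval iota z).

Theorem gk_ring_regular u : (forall P : place iota, 0 <= P x -> 0 <= P u) -> A u.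
Proof.
move=> u_reg.
have sA := @gk_ring_subring n n_ge2 F L iota x y z L_rels.
have evA p : A (ev p) by apply: gk_ring_poly.
have [_ _ _ AM] := sA.
have A_opp p : A (- ev p) by apply: gk_ringN.
pose Q m := `[< exists D : {poly F}, [/\ D != 0, A (u * ev D) & size D = m] >].
have exQ : exists m, Q m.
  have [g [h [Ag Ah h0 uE]]] := L_frac u.
  have hint := gk_ring_integral n_ge2 L_rels Ah.
  have [h' [D [Ah' hh' D0]]] := integral_divides sA A_opp Ah h0 hint.
  exists (size D); apply/asboolP; exists D; split=> //.
    by apply: contraNneq D0 => ->; rewrite rmorph0.
  by rewrite uE -hh' mulrA divfK //; apply: AM.
case: (ex_minnP exQ) => m /asboolP[D [D0 Au <-]] Dmin.
have ev_neq0 p : p != 0 -> ev p != 0.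
  by move=> p0; apply: contraNneq p0 => /(poly_eval_inj n_ge2 L_free) ->.
have [sD|sD] := eqVneq (size D) 1%N.
  have /size_poly1P[c c0 eD] : size D == 1%N by rewrite sD.
  have -> : u = u * ev D * iota c^-1.
    rewrite eD poly_evalE map_polyC hornerC /= fmorphV mulfK // fmorph_eq0 //.
  by apply: AM => //; apply: gk_ring_const.
have [K [jota intK]] := countable_algebraic_closure F.
have [ze rze] : exists ze, root (map_poly jota D) ze.
  by apply/closed_rootP; rewrite size_map_poly.
have [pi [pi0 spi rpi pi_min]] := min_poly_exists D0 rze.
have [g ug] := proj1 (gk_ringP _ _ _ _ _ _) Au.
(* If all coefficients vanish at [ze], the minimal polynomial [pi] divides them and [D]; cancelling
   it contradicts the minimality of [D]. *)
have [alldiv|] := pselect (forall i j, root (map_poly jota (g i j)) ze).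
  have /choice[q qE] i : exists q : 'I_(n ^ 2) -> {poly F}, forall j, g i j = q j * pi.
    have /choice[q qE] j : exists q, g i j = q * pi by apply/dvdpP/pi_min.
    by exists q.
  have /dvdpP[D' eD] : pi %| D by apply: pi_min.
  have D'0 : D' != 0 by apply: contraNneq D0 => D'0; rewrite eD D'0 mul0r.
  suff /Dmin : Q (size D').
    rewrite eD size_mul // -subn1 -addnBA ?(ltnW spi) // leqNgt -[X in (X < _)%N]addn0.
    by rewrite ltn_add2l subn_gt0 spi.
  apply/asboolP; exists D'; split=> //; apply/gk_ringP; exists q.
  apply: (mulIf (ev_neq0 _ pi0)); rewrite -mulrA -rmorphM -eD ug.
  rewrite mulr_suml; apply: eq_bigr => i _; rewrite mulrAC; congr (_ * _).
  rewrite mulr_suml; apply: eq_bigr => j _; rewrite mulrAC; congr (_ * _).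
  by rewrite qE -!poly_evalE rmorphM.
move=> /existsNP[i0 /existsNP[j0 /negP nr]].
have K_char : [pchar K].-nat n by rewrite (pnat_fmorph jota).
have [al [be [K_rels gpt]]] := gk_point_above n_ge2 K_char nr.
have [d1 d1_gt0 al_d] := frobenius_periodic F_char intK al.
have [d2 d2_gt0 be_d] := frobenius_periodic F_char intK be.
have [d3 d3_gt0 ze_d] := frobenius_periodic F_char intK ze.
have per w d e : w ^+ (#|F| ^ d) = w :> K -> w ^+ (#|F| ^ (d * e)) = w.
  by move=> wd; elim: e => [|e IH]; rewrite ?muln0 ?expr1 // mulnS expnD exprM wd.
(* A common multiple of the three periods fixes all coordinates at once. *)
pose d := (d1 * (d2 * d3))%N.
have d_gt0 : (0 < d)%N by rewrite !muln_gt0 d1_gt0 d2_gt0.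
have al_N : al ^+ (#|F| ^ d) = al by apply: per.
have be_N : be ^+ (#|F| ^ d) = be by rewrite /d mulnCA; apply: per.
have ze_N : ze ^+ (#|F| ^ d) = ze.
  by rewrite /d mulnCA mulnC -mulnA mulnC -mulnA; apply: per.
have [P [P1 P2 P3]] := point_place n_ge2 n_char F_char L_rels L_free L_frac
  jota K_rels d_gt0 al_N be_N ze_N.
have Px : 0 <= P x.
  have [->|x0] := eqVneq x 0; first by rewrite ord_at0.
  have [ka] := gk_ring_specializes jota al be ze (@gk_ring_X n n_ge2 F L iota x y z L_rels).
  by move/P1; apply.
have PuD : P (u * ev D) = 0.
  by apply: P2 gpt; apply/specializesP; exists g; rewrite ug.
have PD : 0 < P (ev D).
  apply: P3 (ev_neq0 _ D0).
  have := specializes_ev n_ge2 iota L_rels jota K_rels D.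
  by rewrite [poly_eval jota ze D](rootP rze).
have u0 : u != 0.
  apply: contraNneq gpt => u0; move: ug; rewrite u0 mul0r => /esym/L_free g0.
  by rewrite /gk_elt big1 // => i _; rewrite big1 ?mul0r // => j _;
    rewrite g0 rmorph0 horner0 mul0r.
(* u D(z) is a unit at [P] while D(z) vanishes there, so [u] would have a pole at a place where x is
   regular. *)
have := u_reg P Px; rewrite -(lerDl (P (ev D))) addrC -ord_atM ?ev_neq0 //.
by rewrite PuD leNgt PD.
Qed.

End RegularAffine.

(** * Arithmetic of the orders *)

Section Arithmetic.

Local Open Scope nat_scope.

Lemma radix_inj d q1 r1 q2 r2 : r1 < d -> r2 < d ->
  q1 * d + r1 = q2 * d + r2 -> q1 = q2 /\ r1 = r2.
Proof.
move=> lt1 lt2 e; have er : r1 = r2.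
  by have := congr1 (modn ^~ d) e; rewrite !modnMDl !modn_small.
move: e; rewrite er => /addIn/eqP; rewrite eqn_mul2r => /orP[/eqP d0|/eqP //].
by rewrite d0 in lt1.
Qed.

Variables (n a b c : nat).
Hypotheses (n_ge2 : 2 <= n) (aE : a + n = n ^ 2 + 1) (bE : b = n ^ 3) (cE : c = b + 1).

Lemma c_fact : c = n.+1 * a.
Proof. rewrite cE bE; move: aE; rewrite !expnS expn0 !muln1 => aE'; nia. Qed.

Lemma a_gt0 : 0 < a.
Proof. move: aE; rewrite !expnS expn0 !muln1 => aE'; nia. Qed.

(** Modulo [a], c = 0 and b = -1, which determines [l]; after division by [a], n = -1 modulo n + 1
    determines [j]. The signs explain why the remainders come out exchanged. *)
Lemma infty_radix_inj d1 j1 l1 d2 j2 l2 : j1 < n.+1 -> j2 < n.+1 -> l1 < a -> l2 < a ->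
  c * d1 + n * a * j1 + b * l1 = c * d2 + n * a * j2 + b * l2 -> l1 = l2 /\ j1 = j2.
Proof.
move=> hj1 hj2 hl1 hl2 e.
have [q rl] : n.+1 * (d1 + l1) + n * j1 = n.+1 * (d2 + l2) + n * j2 /\ l2 = l1.
  by apply: (@radix_inj a) => //; move: c_fact cE e => cF cE' e; nia.
split=> //; have [_ //] : d1 + j1 = d2 + j2 /\ j2 = j1.
by apply: (@radix_inj n.+1) => //; nia.
Qed.

Lemma affine_radix_inj d1 j1 l1 d2 j2 l2 : j1 < n.+1 -> j2 < n.+1 -> l1 < a -> l2 < a ->
  c * d1 + a * j1 + l1 = c * d2 + a * j2 + l2 -> l1 = l2 /\ j1 = j2.
Proof.
move=> hj1 hj2 hl1 hl2 e.
have [q rl] : n.+1 * d1 + j1 = n.+1 * d2 + j2 /\ l1 = l2.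
  by apply: (@radix_inj a) => //; move: c_fact e => cF e; nia.
by split=> //; have [] : d1 = d2 /\ j1 = j2 by apply: (@radix_inj n.+1) => //; nia.
Qed.

(** Modulo n, only the coefficient c = 1 of [i] survives. After division by n, [j] is found modulo
    n^2, where n + 1 is the inverse of [a] because (n+1)a = n^3 + 1. *)
Lemma free_radix_inj d1 i1 j1 d2 i2 j2 : i1 < n -> i2 < n -> j1 < n ^ 2 -> j2 < n ^ 2 ->
  b * d1 + c * i1 + n * a * j1 = b * d2 + c * i2 + n * a * j2 -> i1 = i2 /\ j1 = j2.
Proof.
move=> hi1 hi2 hj1 hj2; rewrite cE bE => e.
have [q ri] : n ^ 2 * (d1 + i1) + a * j1 = n ^ 2 * (d2 + i2) + a * j2 /\ i1 = i2.
  apply: (@radix_inj n) => //; move: e; rewrite !expnS expn0 !muln1 => e; nia.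
split=> //.
have [] : n.+1 * d1 + n.+1 * i1 + n * j1 =
  n.+1 * d2 + n.+1 * i2 + n * j2 /\ j1 = j2; last by [].
apply: (@radix_inj (n ^ 2)) => //.
have : n.+1 * a = n * n ^ 2 + 1 by rewrite -c_fact cE bE expnS.
move=> h; nia.
Qed.

(* The entry k - 1 at the last point excludes the single monomial
   y^n z^(a - k) that has the extremal order at all the other points. *)
Lemma pure_gap_arith m k d j l (mu ks : 'I_m -> nat) :
  1 <= m -> m <= n -> 2 <= k <= a -> j < n.+1 -> l < a ->
  (forall s, ks s <= k) -> (forall s, 1 <= ks s) ->
  (forall s : 'I_m, s.+1 = m -> ks s < k) ->
  (forall s, mu s <= d) -> ((forall s, 0 < mu s) -> m <= d) ->
  c * d + n * a * j + b * l + k * b <= n ^ 2 * c ->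
  (forall s, c <= c * mu s + a * j + l + ks s) ->
  (forall s, c < c * mu s + a * j + l + ks s) /\
  c * d + n * a * j + b * l + k * b < n ^ 2 * c.
Proof.
move=> m1 mn /andP[k2 ka] hj hl ksk ks1 ksl mud mum hinf haff.
have cF := c_fact; have b1 : 0 < b by rewrite bE expn_gt0; case: n n_ge2.
have a0 := a_gt0.
(* When every [mu s] is positive the affine bounds are slack, and only equality at infinity remains
   to be excluded. *)
have [allpos|] := pselect (forall s, 0 < mu s).
  have md := mum allpos; split.
    by move=> s; have := allpos s; have := ks1 s; nia.
  rewrite ltn_neqAle hinf andbT; apply/eqP => e.
  have lk : l + k = a.
    have [q qE] : exists q, l + k = q * a.
      (* The quotient results from substituting b = c - 1 and c = (n+1)a in the equality. Since 0 <
         l + k < 2a it must be 1. *)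
      exists (n.+1 * (d + l + k) + n * j - n ^ 2 * n.+1).
      rewrite mulnBl mulnDl -!mulnA.
      have : n ^ 2 * (n.+1 * a) + (l + k) = n.+1 * ((d + l + k) * a) + n * (j * a).
        by rewrite -cF; nia.
      lia.
    clear -qE k2 ka hl a0; case: q qE => [|[|q]]; rewrite ?mulSn; lia.
  have e2 : n.+1 * d + n * j = n ^ 2.
    have : (n.+1 * d + n * j) * a = n ^ 2 * a.
      move: e; have -> : c * d + n * a * j + b * l + k * b =
          (n.+1 * d + n * j) * a + b * (l + k).
        by rewrite cF; lia.
      rewrite lk; have -> : n ^ 2 * c = n ^ 2 * a + b * a by rewrite cF bE expnS; nia.
      lia.
    by move/eqP; rewrite eqn_mul2r eqn0Ngt a0 => /eqP.
  (* In (n+1)d = n(n - j) the factors n and n + 1 are coprime, so n + 1 divides n - j. Hence j = n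
     and d = 0, against 1 <= m <= d. *)
  have := dvdn_mulr d (dvdnn n.+1).
  have -> : n.+1 * d = n * (n - j) by rewrite mulnBr -mulnn in e2 *; lia.
  rewrite Gauss_dvdr ?coprimeSn // => /dvdn_leq njd.
  have jn : j = n by clear -njd hj; lia.
  move: e2; rewrite jn -mulnn => /(canRL (addnK _)); rewrite subnn => /eqP.
  by rewrite muln_eq0 /= => /eqP d0; rewrite d0 leqn0 in md; rewrite (eqP md) in m1.
(* The bound at [s0] now forces j = n, and the one at infinity then forces l + k = a and d = 0. This
   is the exceptional monomial, which violates the bound at the last point. *)
move=> /existsNP[s0 /negP]; rewrite -leqNgt leqn0 => /eqP mu0.
have := haff s0; rewrite mu0 muln0 add0n => h0.
have jn : j = n.
  have := ksk s0; clear -h0 cF hj hl ka => ks0; apply/eqP; rewrite eqn_leq -ltnS hj /=.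
  rewrite leqNgt; apply/negP => jn.
  have : a * j + a <= a * n by rewrite -mulnSr leq_mul2l jn orbT.
  by move: h0; rewrite cF mulSn [(n * a)%N]mulnC; lia.
have hb : c * d + b * (l + k) <= b * a.
  have n2c : n ^ 2 * c = n ^ 2 * a + b * a by rewrite cF bE expnS; nia.
  by move: hinf; rewrite n2c jn -mulnn; lia.
have lk : l + k <= a by rewrite -(leq_pmul2l b1); lia.
have lka : l + k = a.
  by have := ksk s0; move: h0; rewrite cF jn mulSn [(n * a)%N]mulnC; clear -lk; lia.
have d0 : d = 0.
  have c0 : 0 < c by rewrite cE addn1.
  by move: hb; rewrite lka -[X in _ <= X]add0n leq_add2r leqn0 muln_eq0 gtn_eqF //= => /eqP.
have sl : m.-1 < m by rewrite prednK.
have := haff (Ordinal sl); have := ksl (Ordinal sl); have := mud (Ordinal sl).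
rewrite d0 /= prednK // leqn0 => /eqP -> /(_ erefl).
by rewrite muln0 jn cF mulSn [(n * a)%N]mulnC; clear -lka; lia.
Qed.

End Arithmetic.

(** Expanding q(f) = q(r) + q1(f) (f - r) shows that q(f) has order 0, as the nonzero constant q(r)
    dominates. *)
Lemma ord_horner_root (k L : fieldType) (iota : {rmorphism k -> L}) (v : place iota)
    f (r : k) p q mu : f - iota r != 0 -> 0 < v (f - iota r) ->
  ~~ root q r -> p = q * ('X - r%:P) ^+ mu ->
  (map_poly iota p).[f] != 0 /\ v (map_poly iota p).[f] = v (f - iota r) *+ mu.
Proof.
move=> fr0 vfr nr ->; rewrite rmorphM rmorphXn rmorphB /= map_polyX map_polyC /=.
rewrite hornerM horner_exp hornerXsubC.
suff [q0 vq] : (map_poly iota q).[f] != 0 /\ v (map_poly iota q).[f] = 0.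
  split; first by rewrite mulf_neq0 ?expf_neq0.
  by rewrite ord_atM ?expf_neq0 // vq add0r ordX.
have vf (f0 : f != 0) : 0 <= v f.
  rewrite -[f](subrK (iota r)); apply: ordD_ge; rewrite ?subrK // => h; first exact: ltW.
  by rewrite ord_at_const // -(fmorph_eq0 iota).
have [q1 qE] : exists q1, q = q1 * ('X - r%:P) + q.[r]%:P.
  have /factor_theorem[q1 q1E] : root (q - q.[r]%:P) r by rewrite rootE !hornerE subrr.
  by exists q1; rewrite -q1E subrK.
have qr0 : q.[r] != 0 by rewrite rootE in nr.
have -> : (map_poly iota q).[f] = iota q.[r] + (map_poly iota q1).[f] * (f - iota r).
  by rewrite {1}qE rmorphD rmorphM rmorphB /= map_polyX !map_polyC /= !hornerE addrC.
rewrite -(ord_at_const v qr0); apply: ordD_lt; first by rewrite fmorph_eq0.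
rewrite mulf_eq0 negb_or ord_at_const // => /andP[q10 _]; rewrite ord_atM //.
apply: ltr_wpDl => //.
have [f0|f0] := eqVneq f 0; last by apply: ord_horner_ge => //; apply: vf.
have f0' : f = iota 0 by rewrite rmorph0.
move: q10; rewrite f0' horner_map fmorph_eq0 => q10.
by rewrite ord_at_const.
Qed.

Lemma mulrn_int (r : int) (m : nat) : r *+ m = r * m%:Z.
Proof. by rewrite -mulr_natr natz. Qed.

(** * Orders of x, y, z and of monomials at a pole of x and at the points (r, 0, 0) *)

Section GKPlaces.

Variables (n : nat) (n_ge2 : (2 <= n)%N) (F : fieldType) (L : fieldType).
Variables (iota : {rmorphism F -> L}) (x y z : L).
Hypothesis L_rels : gk_relations n x y z.
Variables (a b c : nat).
Hypotheses (aE : (a + n)%N = (n ^ 2 + 1)%N) (bE : b = (n ^ 3)%N) (cE : c = (b + 1)%N).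

Let z_rel : z ^+ a = y ^+ (n ^ 2)%N - y.
Proof.
case: L_rels => _ <-; congr (_ ^+ _).
have : (n <= n ^ 2)%N by rewrite leq_pmulr // ltnW.
lia.
Qed.

(** At a pole the highest powers dominate, so n v(x) = (n+1) v(y) and n^2 v(y) = a v(z). These
    equations fix the orders up to the common factor [s], which [pole_ords] shows to be 1. *)
Lemma ords_at_pole (v : place iota) : v x < 0 -> exists s : nat,
  [/\ (0 < s)%N, v x = - (c * s)%N%:Z, v y = - (n * a * s)%N%:Z, v z = - (b * s)%N%:Z
    & [/\ x != 0, y != 0 & z != 0]].
Proof.
move=> vx.
have x0 : x != 0 by apply: contraTneq vx => ->; rewrite ord_at0.
have [ex _] := L_rels.
have [e1 e2] : x ^+ n + x != 0 /\ v (x ^+ n + x) = v (x ^+ n).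
  apply: ordD_lt; first by rewrite expf_neq0.
  by move=> _; rewrite ordX // mulrn_int; nia.
have y0 : y != 0.
  by apply: contraNneq e1; rewrite ex => ->; rewrite expr0n.
have vy : v y * n.+1%:Z = v x * n%:Z.
  by rewrite -!mulrn_int -!ordX // -ex e2.
have vy0 : v y < 0 by nia.
have [e3 e4] : y ^+ (n ^ 2)%N - y != 0 /\ v (y ^+ (n ^ 2)%N - y) = v (y ^+ (n ^ 2)%N).
  apply: ordD_lt; first by rewrite expf_neq0.
  move=> _; rewrite ordN ordX // mulrn_int.
  have : (n * n = n ^ 2)%N by rewrite mulnn.
  nia.
have a0 := a_gt0 n_ge2 aE bE cE.
have z0 : z != 0.
  by apply: contraNneq e3; rewrite -z_rel => ->; rewrite expr0n (gtn_eqF a0) /= eqxx.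
have vz : v z * a%:Z = v y * (n ^ 2)%N%:Z.
  by rewrite -!mulrn_int -!ordX // z_rel e4.
(* Explicit Bezout combinations: (n+1) - n = 1 makes [p] a common divisor of v(x) and v(y), and
   (n+1)a - n^3 = 1 makes [q] a common divisor of [p] and v(z). *)
pose p := v x - v y; pose q := n.+1%:Z * p - v z.
have cF : (n.+1 * a)%N%:Z = (n ^ 2 * n)%N%:Z + 1.
  by rewrite -(c_fact n_ge2 aE bE cE) cE bE PoszD expnSr.
have xp : v x = n.+1%:Z * p by rewrite /p; lia.
have yp : v y = n%:Z * p by rewrite /p; lia.
have pq : p = a%:Z * q.
  have : a%:Z * q = (n.+1 * a)%N%:Z * p - v z * a%:Z by rewrite /q PoszM; ring.
  by rewrite vz yp cF PoszM => ->; ring.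
have zq : v z = b%:Z * q.
  have a1 : a%:Z != 0 by rewrite eqz_nat gtn_eqF.
  by apply: (mulIf a1); rewrite vz yp pq bE (expnSr n 2) PoszM; ring.
have q0 : q < 0.
  move: vx; rewrite xp pq; clear; nia.
exists `|q|%N; have qE : q = - `|q|%N%:Z by rewrite ltz0_abs // opprK.
split=> //.
- by rewrite absz_gt0 lt_eqF.
- by rewrite xp pq (c_fact n_ge2 aE bE cE) !PoszM mulrA {1}qE mulrN.
- by rewrite yp pq !PoszM mulrA {1}qE mulrN.
- by rewrite zq PoszM {1}qE mulrN.
Qed.

Hypothesis n_char : [pchar F].-nat n.

(** As r^n + r = 0, the first equation reads y^(n+1) = w^n + w with w = x - r. At a zero the linear
    terms w and -y dominate. *)
Lemma ords_at_zero (v : place iota) (r : F) : r ^+ n + r = 0 ->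
  x - iota r != 0 -> 0 < v (x - iota r) -> exists s : nat,
  [/\ (0 < s)%N, v (x - iota r) = (c * s)%N%:Z, v y = (a * s)%N%:Z, v z = s%:Z
    & y != 0 /\ z != 0].
Proof.
move=> r_root w0; set w := x - iota r in w0 * => vw.
have [ex _] := L_rels.
have yw : y ^+ n.+1 = w ^+ n + w.
  have chL : [pchar L].-nat n by rewrite (pnat_fmorph iota).
  rewrite -ex exprB_pchar ?(ltnW n_ge2) // addrACA -opprD -rmorphXn -rmorphD r_root.
  by rewrite rmorph0 subr0.
have [e1 e2] : w + w ^+ n != 0 /\ v (w + w ^+ n) = v w.
  apply: ordD_lt => // _; rewrite ordX // mulrn_int; nia.
have y0 : y != 0.
  by apply: contraNneq e1; rewrite addrC -yw => ->; rewrite expr0n.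
have vy : v y * n.+1%:Z = v w.
  by rewrite -!mulrn_int -!ordX // yw addrC e2.
have vy0 : 0 < v y by nia.
have [e3 e4] : - y + y ^+ (n ^ 2)%N != 0 /\ v (- y + y ^+ (n ^ 2)%N) = v (- y).
  apply: ordD_lt; rewrite ?oppr_eq0 // => _; rewrite ordN ordX // mulrn_int.
  have : (n * n = n ^ 2)%N by rewrite mulnn.
  nia.
have a0 := a_gt0 n_ge2 aE bE cE.
have z0 : z != 0.
  by apply: contraNneq e3; rewrite addrC -z_rel => ->; rewrite expr0n (gtn_eqF a0) /= eqxx.
have vz : v z * a%:Z = v y.
  by rewrite -!mulrn_int -!ordX // z_rel addrC e4 ordN.
have vz0 : 0 < v z by nia.
have vzE : v z = `|v z|%N%:Z by rewrite gtz0_abs.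
exists `|v z|%N; split=> //.
- by rewrite absz_gt0 gt_eqF.
- by rewrite -vy -vz {1}vzE (c_fact n_ge2 aE bE cE) !PoszM; ring.
- by rewrite -vz {1}vzE !PoszM mulrC.
Qed.

End GKPlaces.

Lemma ord_sum2_distinct (k L : fieldType) (iota : {rmorphism k -> L}) (v : place iota)
    (I J : finType) (t : I -> J -> L) :
  (forall i j i' j', t i j != 0 -> t i' j' != 0 -> v (t i j) = v (t i' j') ->
     i = i' /\ j = j') ->
  (forall i j, t i j = 0) \/ exists i0 j0,
    [/\ t i0 j0 != 0, \sum_i \sum_j t i j != 0, v (\sum_i \sum_j t i j) = v (t i0 j0)
      & forall i j, t i j != 0 -> v (t i0 j0) <= v (t i j)].
Proof.
move=> inj; rewrite pair_big /=.
have [|t0|[[i0 j0] [t0 s0 vs mini]]] :=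
  @ord_sumT_distinct _ _ _ v _ (fun p : I * J => t p.1 p.2).
- by move=> [i j] [i' j'] /= ti tj e; have [-> ->] := inj _ _ _ _ ti tj e.
- by left=> i j; apply: (t0 (i, j)).
- by right; exists i0, j0; split=> // i j; apply: (mini (i, j)).
Qed.

Section Monomials.

Variables (n : nat) (n_ge2 : (2 <= n)%N) (F : fieldType) (L : fieldType).
Variables (iota : {rmorphism F -> L}) (x y z : L).
Hypothesis L_rels : gk_relations n x y z.
Variables (a b c : nat).
Hypotheses (aE : (a + n)%N = (n ^ 2 + 1)%N) (bE : b = (n ^ 3)%N) (cE : c = (b + 1)%N).

Definition monomial (p : {poly F}) (j l : nat) : L :=
  (map_poly iota p).[x] * y ^+ j * z ^+ l.

Definition gk_sum (T : 'I_a -> 'I_n.+1 -> {poly F}) : L :=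
  \sum_(l < a) \sum_(j < n.+1) monomial (T l j) j l.

(** The same ring through another tower: y^(n+1) = x^n + x is a relation over F[x], and z^a =
    y^(n^2) - y one over F[x, y]. *)
Lemma gk_ring_sum f : gk_ring n iota x y z f -> exists T, f = gk_sum T.
Proof.
have a0 := a_gt0 n_ge2 aE bE cE.
have [ex ez] := L_rels.
pose S1 := poly_val iota x; pose S2 := pow_span S1 y n.+1.
have sS1 : subring S1 by apply: poly_val_subring.
have sS2 : subring S2.
  apply: pow_span_subring => //; apply: pow_span_sub => //; rewrite -ex.
  by exists ('X^n + 'X); rewrite rmorphD /= map_polyXn map_polyX !hornerE.
have S2_poly p : S2 (map_poly iota p).[x] by apply: pow_span_sub => //; exists p.
have S2_const e : S2 (iota e) by have := S2_poly e%:P; rewrite map_polyC hornerC.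
have S2y : S2 y by rewrite -[y]expr1; apply: pow_span_gen => //; rewrite ltnS ltnW.
have za : pow_span S2 z a (z ^+ a).
  apply: pow_span_sub => //; have -> : a = (n ^ 2 - n + 1)%N.
    have : (n <= n ^ 2)%N by rewrite leq_pmulr // ltnW.
    by move: aE; clear; lia.
  rewrite ez -mulN1r -(rmorph1 iota) -rmorphN; case: (sS2) => _ _ AD AM.
  by apply: AD; [apply: subringX|apply: AM].
have sS3 : subring (pow_span S2 z a) by apply: pow_span_subring.
move=> Af; have : pow_span S2 z a f.
  apply: gk_ring_min Af => //.
  - by move=> e; apply: pow_span_sub.
  - by apply: pow_span_sub => //; have := S2_poly 'X; rewrite map_polyX hornerX.
  - exact: pow_span_sub.
  - exact: pow_span_mem.
case=> s Hs ->.
have /choice[T TE] l : exists T : 'I_n.+1 -> {poly F},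
    s l = \sum_(j < n.+1) (map_poly iota (T j)).[x] * y ^+ j.
  have [e /choice[T TE] ->] := Hs l; exists T.
  by apply: eq_bigr => j _; rewrite TE.
by exists T; apply: eq_bigr => l _; rewrite TE mulr_suml.
Qed.

Section Pole.

Variables (v : place iota) (vx : v x < 0).

Lemma monomial_pole s : [/\ v x = - (c * s)%N%:Z, v y = - (n * a * s)%N%:Z,
    v z = - (b * s)%N%:Z & [/\ x != 0, y != 0 & z != 0]] ->
  forall p j l, p != 0 -> monomial p j l != 0 /\
    v (monomial p j l) = - ((c * (size p).-1 + n * a * j + b * l) * s)%N%:Z.
Proof.
move=> [vxE vyE vzE [x0 y0 z0]] p j l p0.
have [px0 vp] := ord_horner_pole vx p0; split; first by rewrite !mulf_neq0 ?expf_neq0.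
rewrite !ord_atM ?mulf_neq0 ?expf_neq0 // !ordX // vp vxE vyE vzE !mulrn_int.
by rewrite !PoszM !PoszD !PoszM; ring.
Qed.

Lemma gk_free g : gk_elt iota x y z g = 0 ->
  forall (i : 'I_n) (j : 'I_(n ^ 2)), g i j = 0.
Proof.
move=> g0 i j; apply/eqP/negPn/negP => gij.
have [s [s0 vxE vyE vzE [x0 y0 z0]]] := ords_at_pole n_ge2 L_rels aE bE cE vx.
have vz : v z < 0.
  rewrite vzE oppr_lt0 ltz_nat muln_gt0 s0 bE expn_gt0 orbF andbT; exact: ltnW.
have a0 := a_gt0 n_ge2 aE bE cE.
pose t (i : 'I_n) (j : 'I_(n ^ 2)) := (map_poly iota (g i j)).[z] * y ^+ j * x ^+ i.
have tE i' j' : g i' j' != 0 -> t i' j' != 0 /\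
    v (t i' j') = - ((b * (size (g i' j')).-1 + c * i' + n * a * j') * s)%N%:Z.
  move=> p0; have [px0 vp] := ord_horner_pole vz p0.
  split; first by rewrite !mulf_neq0 ?expf_neq0.
  rewrite !ord_atM ?mulf_neq0 ?expf_neq0 // !ordX // vp vxE vyE vzE !mulrn_int.
  by rewrite !PoszM !PoszD !PoszM; ring.
have t0g i' j' : t i' j' != 0 -> g i' j' != 0.
  by apply: contraNneq => h; rewrite /t h rmorph0 horner0 !mul0r.
have sumt : \sum_i \sum_j t i j = 0.
  rewrite -[RHS]g0; apply: eq_bigr => i' _; rewrite mulr_suml.
  by apply: eq_bigr.
have [|t0|[i0 [j0 [_ /eqP]]]] := @ord_sum2_distinct _ _ _ v _ _ t.
- move=> i1 j1 i2 j2 /t0g/tE[_ ->] /t0g/tE[_ ->] /oppr_inj/eqP.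
  rewrite eqz_nat eqn_mul2r gtn_eqF //= => /eqP.
  move/(free_radix_inj n_ge2 aE bE cE) => [|||| e1 e2] //.
  by split; apply: val_inj.
- by have [] := tE _ _ gij; rewrite t0 eqxx.
- by rewrite sumt.
Qed.

End Pole.

End Monomials.

(** * Pure gaps from strict inequalities *)

Section RiemannRoch.

Variables (k L : fieldType) (iota : {rmorphism k -> L}).

Lemma coeff_divisor_of r (R : 'I_r -> place iota) (u : 'I_r -> nat) Q :
  coeff Q (divisor_of R u) = \sum_(i < r) ((R i == Q) * u i)%N%:Z.
Proof.
rewrite raddf_sum; apply: eq_bigr => i _; rewrite /= coeffMn coeffU mul1r.
by rewrite mulrn_int PoszM natz.
Qed.

Lemma coeff_divisor_of_inj r (R : 'I_r -> place iota) (u : 'I_r -> nat) i :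
  injective R -> coeff (R i) (divisor_of R u) = (u i)%:Z.
Proof.
move=> injR; rewrite coeff_divisor_of (bigD1 i) //= eqxx mul1n big1 ?addr0 // => j ji.
by rewrite (inj_eq injR) (negPf ji).
Qed.

Lemma coeff_divisor_of_out r (R : 'I_r -> place iota) (u : 'I_r -> nat) Q :
  (forall i, R i <> Q) -> coeff Q (divisor_of R u) = 0.
Proof.
by move=> RQ; rewrite coeff_divisor_of big1 // => i _; have /eqP/negPf-> := RQ i.
Qed.

Lemma RR_space_linear (G : divisor iota) d (e : 'I_d -> L) (c : 'I_d -> k) :
  (forall i, RR_space G (e i)) -> RR_space G (\sum_i iota (c i) * e i).
Proof.
move=> Ve; have [->|s0] := eqVneq (\sum_i iota (c i) * e i) 0; [by left|right].
split=> // Q; rewrite -lerBlDr sub0r; apply: ord_sum_ge s0 => i _.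
rewrite mulf_eq0 fmorph_eq0 negb_or => /andP[c0 e0].
rewrite ord_atM ?fmorph_eq0 // ord_at_const // add0r.
case: (Ve i) e0 => [->|[_ /(_ Q)] + _]; first by rewrite eqxx.
by rewrite -[in X in _ -> X]subr_ge0 opprK.
Qed.

(** If no function of L(G) attains a bound at any R_j, then L(G) and L(G - R_j) have the same
    elements. A function with pole divisor G would attain the bound at the point with positive
    entry. *)
Lemma pure_gap_of_strict r (R : 'I_r -> place iota) (u : 'I_r -> nat) :
  injective R -> (exists i, (0 < u i)%N) ->
  (exists d, has_dim iota (RR_space (divisor_of R u)) d) ->
  (forall f, f != 0 -> (forall Q, 0 <= ord_at Q f + coeff Q (divisor_of R u)) ->
     forall i, 0 < R i f + (u i)%:Z) ->
  pure_gap R u.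
Proof.
move=> injR [i0 ui0] [d dimV] strict; split.
  move=> [f [f0 fE]].
  have /(strict f f0)/(_ i0) : forall Q, 0 <= ord_at Q f + coeff Q (divisor_of R u).
    by move=> Q; rewrite fE -lerBlDl sub0r le_max lexx.
  have := fE (R i0); rewrite coeff_divisor_of_inj //.
  have := ui0; clear; lia.
move=> j; exists d; split=> //.
have sub f : RR_space (divisor_of R u) f ->
    RR_space (divisor_of R u - point_divisor (R j)) f.
  move=> [->|[f0 fG]]; [by left|right; split=> // Q].
  rewrite coeffB coeffU mul1r; have [RQ|RQ] := eqVneq (R j) Q; last by rewrite subr0.
  by rewrite -RQ coeff_divisor_of_inj // addrA subr_ge0; apply: strict.
case: dimV => e [Ve ind span]; exists e; split=> // [i|f].
  exact/sub/Ve.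
move=> [->|[f0 fG]]; apply: span; [by left|right; split=> // Q].
apply: le_trans (fG Q) _; rewrite lerD2l coeffB coeffU mul1r gerBl.
by case: eqP.
Qed.

End RiemannRoch.

(** * Exact orders of the normal forms over F[x] *)

Section Orders.

Variables (n : nat) (n_ge2 : (2 <= n)%N) (F : fieldType) (L : fieldType).
Variables (iota : {rmorphism F -> L}) (x y z : L).
Hypothesis L_rels : gk_relations n x y z.
Hypothesis L_frac : forall f, exists g h,
  [/\ gk_ring n iota x y z g, gk_ring n iota x y z h, h != 0 & f = g / h].
Variables (a b c : nat).
Hypotheses (aE : (a + n)%N = (n ^ 2 + 1)%N) (bE : b = (n ^ 3)%N) (cE : c = (b + 1)%N).

Local Notation mon := (monomial iota x y z).

(** Stated for any place, since the pole and the zeros differ only in the formula for the order of a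
    monomial. *)
Lemma gk_sum_ord (v : place iota) (T : 'I_a -> 'I_n.+1 -> {poly F}) :
  (forall p j l, p != 0 -> mon p j l != 0) ->
  (forall p j l p' j' l', p != 0 -> p' != 0 -> (j < n.+1)%N -> (j' < n.+1)%N ->
     (l < a)%N -> (l' < a)%N -> v (mon p j l) = v (mon p' j' l') -> l = l' /\ j = j') ->
  gk_sum iota x y z T != 0 ->
  exists l0 j0, [/\ T l0 j0 != 0, v (gk_sum iota x y z T) = v (mon (T l0 j0) j0 l0)
    & forall l j, T l j != 0 -> v (gk_sum iota x y z T) <= v (mon (T l j) j l)].
Proof.
move=> mon0 inj T0.
have t0 p j l : mon p j l != 0 -> p != 0.
  by apply: contraNneq => ->; rewrite /monomial rmorph0 horner0 !mul0r.
have [|h0|[l0 [j0 [t00 _ vs mini]]]] := @ord_sum2_distinct _ _ _ v _ _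
    (fun (l : 'I_a) (j : 'I_n.+1) => mon (T l j) j l).
- move=> l j l' j' /t0 h1 /t0 h2 e.
  have [] := inj _ _ _ _ _ _ h1 h2 (ltn_ord j) (ltn_ord j') (ltn_ord l) (ltn_ord l') e.
  by move=> /val_inj-> /val_inj->.
- case/eqP: T0; rewrite /gk_sum big1 // => l _; rewrite big1 // => j _; exact: h0.
- exists l0, j0; split; [exact: t0 t00|exact: vs|].
  by move=> l j Tlj; rewrite vs; apply/mini/mon0.
Qed.

(** L is the fraction field of A, so all orders are multiples of [s]; but a place takes the value 1.
    This replaces a computation of ramification indices. *)
Lemma ord_normalized (v : place iota) (s : nat) :
  (forall f, gk_ring n iota x y z f -> f != 0 -> exists e : int, v f = e * s%:Z) ->
  s = 1%N.
Proof.
move=> vA; have [t vt] := ord_at_surj v.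
have t0 : t != 0.
  by apply/eqP => t0; move: vt; rewrite t0 ord_at0.
have [g [h [Ag Ah h0 tE]]] := L_frac t.
have g0 : g != 0 by apply: contraNneq t0 => g0; rewrite tE g0 mul0r.
have [e1 E1] := vA g Ag g0; have [e2 E2] := vA h Ah h0.
move: vt; rewrite tE ord_div // E1 E2 -mulrBl => /(congr1 absz)/eqP.
by rewrite abszM muln_eq1 => /andP[_ /eqP].
Qed.

Section Pole.

Variables (v : place iota) (vx : v x < 0).

Lemma pole_ords : [/\ v x = - c%:Z, v y = - (n * a)%N%:Z, v z = - b%:Z &
  [/\ x != 0, y != 0 & z != 0]].
Proof.
have [s [s0 vxE vyE vzE nz]] := ords_at_pole n_ge2 L_rels aE bE cE vx.
have monE := monomial_pole vx (And4 vxE vyE vzE nz).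
suff s1 : s = 1%N by move: vxE vyE vzE; rewrite s1 !muln1.
apply: (@ord_normalized v) => // f /(gk_ring_sum n_ge2 L_rels aE bE cE)[T ->] T0.
have [||l0 [j0 [T00 -> _]]] := gk_sum_ord (v := v) _ _ T0.
- by move=> p j l /(monE p j l)[].
- move=> p j l p' j' l' p0 p0' hj hj' hl hl'.
  have [_ ->] := monE p j l p0; have [_ ->] := monE p' j' l' p0'.
  move/oppr_inj/eqP; rewrite eqz_nat eqn_mul2r gtn_eqF //= => /eqP.
  by apply: (infty_radix_inj n_ge2 aE bE cE).
- have [_ ->] := monE _ j0 l0 T00.
  by exists (- (c * (size (T l0 j0)).-1 + n * a * j0 + b * l0)%N%:Z); rewrite mulNr PoszM.
Qed.

Lemma pole_monomial p j l : p != 0 -> mon p j l != 0 /\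
  v (mon p j l) = - (c * (size p).-1 + n * a * j + b * l)%N%:Z.
Proof.
have [vxE vyE vzE nz] := pole_ords.
have := @monomial_pole n F L iota x y z a b c v vx 1%N; rewrite !muln1.
by move=> /(_ (And4 vxE vyE vzE nz) p j l); rewrite muln1.
Qed.

Lemma pole_gk_sum T : gk_sum iota x y z T != 0 ->
  exists l0 j0, [/\ T l0 j0 != 0, v (gk_sum iota x y z T) = v (mon (T l0 j0) j0 l0)
    & forall (l : 'I_a) (j : 'I_n.+1), T l j != 0 ->
      v (gk_sum iota x y z T) <= v (mon (T l j) j l)].
Proof.
apply: gk_sum_ord => [p j l /(pole_monomial j l)[] //|].
move=> p j l p' j' l' p0 p0' hj hj' hl hl'.
have [_ ->] := pole_monomial j l p0; have [_ ->] := pole_monomial j' l' p0'.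
move/oppr_inj/eqP; rewrite eqz_nat => /eqP.
by apply: (infty_radix_inj n_ge2 aE bE cE).
Qed.

End Pole.

Lemma poly_factor (p : {poly F}) (r : F) : p != 0 ->
  exists mu q, ~~ root q r /\ p = q * ('X - r%:P) ^+ mu.
Proof.
move=> p0; have [mu [q]] := multiplicity_XsubC p r; rewrite p0 /= => nr pE.
by exists mu, q.
Qed.

Hypothesis n_char : [pchar F].-nat n.
Hypothesis monomial_neq0 : forall p j l, p != 0 -> mon p j l != 0.

Section Zero.

Variables (v : place iota) (r : F).
Hypotheses (r_root : r ^+ n + r = 0) (xr0 : x - iota r != 0) (vxr : 0 < v (x - iota r)).

Lemma zero_monomial_gen s : v (x - iota r) = (c * s)%N%:Z -> v y = (a * s)%N%:Z ->
  v z = s%:Z -> y != 0 /\ z != 0 ->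
  forall p q mu j l, ~~ root q r -> p = q * ('X - r%:P) ^+ mu ->
    v (mon p j l) = ((c * mu + a * j + l) * s)%N%:Z.
Proof.
move=> vxE vyE vzE [y0 z0] p q mu j l nr pE.
have [px0 vp] := ord_horner_root xr0 vxr nr pE.
rewrite !ord_atM ?mulf_neq0 ?expf_neq0 // !ordX // vp vxE vyE vzE !mulrn_int.
by rewrite !PoszM !PoszD !PoszM; ring.
Qed.

Lemma zero_ords : [/\ v (x - iota r) = c%:Z, v y = a%:Z, v z = 1 & y != 0 /\ z != 0].
Proof.
have [s [s0 vxE vyE vzE nz]] := ords_at_zero n_ge2 L_rels aE bE cE n_char r_root xr0 vxr.
have monE := zero_monomial_gen vxE vyE vzE nz.
suff s1 : s = 1%N by move: vxE vyE vzE; rewrite s1 !muln1.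
apply: (@ord_normalized v) => // f /(gk_ring_sum n_ge2 L_rels aE bE cE)[T ->] T0.
have [//||l0 [j0 [T00 -> _]]] := gk_sum_ord (v := v) _ _ T0.
- move=> p j l p' j' l' p0 p0' hj hj' hl hl'.
  have [mu [q [nr pE]]] := poly_factor r p0; have [mu' [q' [nr' pE']]] := poly_factor r p0'.
  rewrite (monE _ _ _ _ _ nr pE) (monE _ _ _ _ _ nr' pE').
  move/eqP; rewrite eqz_nat eqn_mul2r gtn_eqF //= => /eqP.
  by apply: (affine_radix_inj n_ge2 aE bE cE).
- have [mu [q [nr pE]]] := poly_factor r T00.
  rewrite (monE _ _ _ _ _ nr pE).
  by exists (c * mu + a * j0 + l0)%N%:Z; rewrite PoszM.
Qed.

Lemma zero_monomial p q mu j l : ~~ root q r -> p = q * ('X - r%:P) ^+ mu ->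
  v (mon p j l) = (c * mu + a * j + l)%N%:Z.
Proof.
have [vxE vyE vzE nz] := zero_ords.
have := @zero_monomial_gen 1%N; rewrite !muln1 => /(_ vxE vyE vzE nz p q mu j l).
by rewrite muln1.
Qed.

Lemma zero_gk_sum T : gk_sum iota x y z T != 0 ->
  exists l0 j0, [/\ T l0 j0 != 0, v (gk_sum iota x y z T) = v (mon (T l0 j0) j0 l0)
    & forall (l : 'I_a) (j : 'I_n.+1), T l j != 0 ->
      v (gk_sum iota x y z T) <= v (mon (T l j) j l)].
Proof.
apply: gk_sum_ord => // p j l p' j' l' p0 p0' hj hj' hl hl'.
have [mu [q [nr pE]]] := poly_factor r p0; have [mu' [q' [nr' pE']]] := poly_factor r p0'.
rewrite (zero_monomial _ _ nr pE) (zero_monomial _ _ nr' pE').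
by move/eqP; rewrite eqz_nat => /eqP; apply: (affine_radix_inj n_ge2 aE bE cE).
Qed.

End Zero.

End Orders.

Lemma ord_prod (k L : fieldType) (iota : {rmorphism k -> L}) (v : place iota)
    (I : finType) (f : I -> L) : (forall i, f i != 0) ->
  v (\prod_i f i) = \sum_i v (f i).
Proof.
move=> f0; have : \prod_i f i != 0 /\ v (\prod_i f i) = \sum_i v (f i); last by case.
apply: (big_ind2 (fun g e => g != 0 /\ v g = e)) => [|g e g' e' [g0 <-] [g0' <-]|i _].
- by rewrite oner_eq0 ord_at1.
- by rewrite mulf_neq0 // ord_atM.
- by split.
Qed.

Lemma ord_sub_const_ge0 (k L : fieldType) (iota : {rmorphism k -> L}) (v : place iota) f r :
  0 <= v f -> 0 <= v (f - iota r).
Proof.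
move=> vf; have [->|fr] := eqVneq (f - iota r) 0; first by rewrite ord_at0.
apply: ordD_ge => //; rewrite oppr_eq0 fmorph_eq0 => r0.
by rewrite ordN ord_at_const.
Qed.

(** * Riemann-Roch spaces at the points above y = z = 0 *)

Section Main.

Variables (n : nat) (n_ge2 : (2 <= n)%N) (F : finFieldType).
Hypothesis n_char : [pchar F].-nat n.
Hypothesis F_char : [pchar F].-nat #|F|.
Variables (L : fieldType) (iota : {rmorphism F -> L}) (x y z : L).
Hypothesis L_rels : gk_relations n x y z.
Hypothesis L_frac : forall f, exists g h,
  [/\ gk_ring n iota x y z g, gk_ring n iota x y z h, h != 0 & f = g / h].
Variables (a b c : nat).
Hypotheses (aE : (a + n)%N = (n ^ 2 + 1)%N) (bE : b = (n ^ 3)%N) (cE : c = (b + 1)%N).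
Variables (Pinf : place iota) (Pinf_x : Pinf x < 0).
Variables (m : nat) (m_gt0 : (0 < m)%N) (m_le : (m <= n)%N).
Variables (r : 'I_m -> F) (P : 'I_m -> place iota).
Hypothesis r_inj : injective r.
Hypothesis r_root : forall s, r s ^+ n + r s = 0.
Hypothesis xr_neq0 : forall s, x - iota (r s) != 0.
Hypothesis P_xr : forall s, 0 < P s (x - iota (r s)).
Variables (k N : nat) (ks : 'I_m -> nat).
Hypothesis k_bnd : (2 <= k <= a)%N.
Hypothesis ks_le : forall s, (ks s <= k)%N.
Hypothesis ks_gt0 : forall s, (1 <= ks s)%N.
Hypothesis ks_last : forall s : 'I_m, s.+1 = m -> (ks s < k)%N.
Hypothesis N_gt0 : (0 < N)%N.
Hypothesis N_eq : (N + m * c + k * b)%N = (n ^ 2 * c)%N.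

Let R (i : 'I_m.+1) := if unlift ord0 i is Some s then P s else Pinf.
Let u (i : 'I_m.+1) := if unlift ord0 i is Some s then ks s else N.
Let G := divisor_of R u.
Let Pi := \prod_s (x - iota (r s)).

Local Notation mon := (monomial iota x y z).
Local Notation Pinf_monomial := (pole_monomial n_ge2 L_rels L_frac aE bE cE Pinf_x).

(** Nonvanishing is read off at Pinf, where the leading term decides, and is then used at the
    P_s. *)
Let mon_neq0 p j l : p != 0 -> mon p j l != 0.
Proof. by move=> p0; have [] := Pinf_monomial j l p0. Qed.

Local Notation P_ords s := (zero_ords n_ge2 L_rels L_frac aE bE cE n_char mon_neq0
  (r_root s) (xr_neq0 s) (P_xr s)).
Local Notation P_monomial s := (zero_monomial n_ge2 L_rels L_frac aE bE cE n_char mon_neq0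
  (r_root s) (xr_neq0 s) (P_xr s)).

Let P_x s : 0 <= P s x.
Proof.
have := ord_sub_const_ge0 (- r s) (ltW (P_xr s)).
by rewrite rmorphN opprK subrK.
Qed.

Let P_xr_other s t : t != s -> P s (x - iota (r t)) = 0.
Proof.
move=> ts; have rst : r s - r t != 0 by rewrite subr_eq0 (inj_eq r_inj) eq_sym.
rewrite -(ord_at_const (P s) rst) rmorphB.
have -> : x - iota (r t) = iota (r s) - iota (r t) + (x - iota (r s)) by ring.
have [||_ ->//] := @ordD_lt _ _ _ (P s) (iota (r s) - iota (r t)) (x - iota (r s)).
  by rewrite -rmorphB fmorph_eq0.
by move=> _; rewrite -rmorphB ord_at_const.
Qed.

Let Pinf_xr s : Pinf (x - iota (r s)) = - c%:Z.
Proof.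
have [vx _ _ [x0 _ _]] := pole_ords n_ge2 L_rels L_frac aE bE cE Pinf_x.
rewrite -vx; have [||_ ->//] := @ordD_lt _ _ _ Pinf x (- iota (r s)) => //.
by rewrite oppr_eq0 fmorph_eq0 => rs; rewrite ordN ord_at_const.
Qed.

Let Pi_neq0 : Pi != 0.
Proof. by apply/prodf_neq0 => s _; apply: xr_neq0. Qed.

Let P_Pi s : P s Pi = c%:Z.
Proof.
rewrite ord_prod // (bigD1 s) //= big1 ?addr0; last by move=> t; apply: P_xr_other.
by case: (P_ords s).
Qed.

Let Pinf_Pi : Pinf Pi = - (m * c)%N%:Z.
Proof.
rewrite ord_prod //; under eq_bigr do rewrite Pinf_xr.
by rewrite sumr_const card_ord mulrn_int PoszM mulNr mulrC.
Qed.

Let R_inj : injective R.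
Proof.
have PinfP s : Pinf <> P s by move=> e; have := P_x s; rewrite -e leNgt Pinf_x.
move=> i j; rewrite /R; case: (unliftP ord0 i) => [s|] ->;
  case: (unliftP ord0 j) => [t|] -> //.
- move=> e; congr fintype.lift; apply/eqP; apply: contraT => st.
  by have := P_xr s; rewrite e P_xr_other.
- by move/esym/PinfP.
- by move/PinfP.
Qed.

Let R0 : R ord0 = Pinf. Proof. by rewrite /R unlift_none. Qed.
Let RS s : R (fintype.lift ord0 s) = P s. Proof. by rewrite /R liftK. Qed.
Let u0 : u ord0 = N. Proof. by rewrite /u unlift_none. Qed.
Let uS s : u (fintype.lift ord0 s) = ks s. Proof. by rewrite /u liftK. Qed.
Let G_Pinf : coeff Pinf G = N%:Z.
Proof. by rewrite -R0 coeff_divisor_of_inj // u0. Qed.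
Let G_P s : coeff (P s) G = (ks s)%:Z.
Proof. by rewrite -RS coeff_divisor_of_inj // uS. Qed.

Section Function.

Variables (f : L) (f_neq0 : f != 0) (f_G : forall Q, 0 <= ord_at Q f + coeff Q G).

Let fPi_neq0 : f * Pi != 0. Proof. by rewrite mulf_neq0. Qed.

(** At P_s the pole of [f] has order at most k <= a <= c, and [Pi] vanishes to order c there. At any
    other place where x is regular neither factor has a pole. *)
Lemma RR_mul_poles : gk_ring n iota x y z (f * Pi).
Proof.
have a_le_c : (a <= c)%N by rewrite (c_fact n_ge2 aE bE cE) leq_pmull.
have L_free := gk_free n_ge2 L_rels aE bE cE Pinf_x.
apply: (gk_ring_regular n_ge2 n_char F_char L_rels L_free L_frac) => Q Qx.
rewrite ord_atM //; have fQ := f_G Q.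
have [[s PQ]|noQ] := pselect (exists s, P s = Q).
  rewrite -PQ P_Pi; have := f_G (P s); rewrite G_P.
  have := ks_le s; case/andP: k_bnd => _; move: a_le_c; clear; lia.
have Qf : 0 <= ord_at Q f.
  have := f_G Q; rewrite coeff_divisor_of_out ?addr0 // => i.
  rewrite /R; case: (unliftP ord0 i) => [s _ PQ|_ PQ]; first by apply: noQ; exists s.
  by move: Qx; rewrite -PQ leNgt Pinf_x.
apply: addr_ge0 => //; rewrite ord_prod //; apply: sumr_ge0 => s _.
exact: ord_sub_const_ge0.
Qed.

Variable T : 'I_a -> 'I_n.+1 -> {poly F}.
Hypothesis f_T : f * Pi = gk_sum iota x y z T.

Let T_neq0 : gk_sum iota x y z T != 0. Proof. by rewrite -f_T. Qed.

(** These supply the two hypotheses of [pure_gap_arith] that relate degree and multiplicities; the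
    second counts the distinct roots r_s. *)
Let poly_bounds (p : {poly F}) (mu : 'I_m -> nat) (q : 'I_m -> {poly F}) : p != 0 ->
  (forall s, ~~ root (q s) (r s) /\ p = q s * ('X - (r s)%:P) ^+ mu s) ->
  (forall s, (mu s <= (size p).-1)%N) /\
  ((forall s, (0 < mu s)%N) -> (m <= (size p).-1)%N).
Proof.
move=> p0 qP; have sp : (0 < size p)%N by rewrite size_poly_gt0.
split=> [s|mu0].
  have [nr pE] := qP s.
  have q0 : q s != 0 by apply: contraNneq nr => ->; rewrite root0.
  rewrite pE size_mul // ?expf_neq0 ?polyXsubC_eq0 // size_exp_XsubC addnS /=.
  rewrite -size_poly_gt0 in q0.
  by rewrite -ltnS prednK ?addn_gt0 ?q0 // -addn1 addnC leq_add2r.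
rewrite -ltnS prednK //; have -> : m = size [seq r s | s <- enum 'I_m].
  by rewrite size_map size_enum_ord.
apply: max_poly_roots => //; last by rewrite map_inj_uniq ?enum_uniq.
apply/allP => _ /mapP[s _ ->]; have [_ ->] := qP s.
have := mu0 s; case: (mu s) => // e _.
by rewrite rootE hornerM horner_exp hornerXsubC subrr expr0n mulr0.
Qed.

Let term_bounds l j mu q : T l j != 0 ->
  (forall s, ~~ root (q s) (r s) /\ T l j = q s * ('X - (r s)%:P) ^+ mu s) ->
  (c * (size (T l j)).-1 + n * a * j + b * l + k * b <= n ^ 2 * c)%N /\
  (forall s, (c <= c * mu s + a * j + l + ks s)%N).
Proof.
move=> Tlj qP; split=> [|s].
  have [_ [_ [_ _ /(_ l j Tlj)]]] := pole_gk_sum n_ge2 L_rels L_frac aE bE cE Pinf_x T_neq0.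
  have [_ ->] := Pinf_monomial j l Tlj; rewrite -f_T ord_atM // Pinf_Pi.
  have := f_G Pinf; rewrite G_Pinf; move: N_eq; clear.
  move: (c * _ + _ + _)%N (n ^ 2 * c)%N (m * c)%N (k * b)%N (ord_at _ _) => A B C D v; lia.
have [_ [_ [_ _ /(_ l j Tlj)]]] := zero_gk_sum n_ge2 L_rels L_frac aE bE cE n_char mon_neq0
  (r_root s) (xr_neq0 s) (P_xr s) T_neq0.
have [nr pE] := qP s; rewrite (P_monomial s _ _ nr pE) -f_T ord_atM // P_Pi.
have := f_G (P s); rewrite G_P; clear.
move: (c * mu s + a * j + l)%N (ord_at _ _) => A v; lia.
Qed.

(** The bound at Pinf gives c deg T <= n^2 c. Finitely many monomials therefore span L(G). *)
Lemma RR_degree l j : T l j != 0 -> (size (T l j) <= (n ^ 2).+1)%N.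
Proof.
move=> Tlj; have /choice[mq mqP] s := poly_factor (r s) Tlj.
have /choice[q qP] := mqP.
have [h _] := term_bounds Tlj qP.
have c0 : (0 < c)%N by rewrite cE addn1.
apply: leq_trans (leqSpred _) _; rewrite ltnS -(leq_pmul2l c0) [(c * n ^ 2)%N]mulnC.
by apply: leq_trans h; rewrite -!addnA leq_addr.
Qed.

(** At each place the order of f Pi is the order of one of its terms, and for every term the bounds
    are strict. *)
Lemma RR_strict i : 0 < R i f + (u i)%:Z.
Proof.
have strict l j : T l j != 0 -> exists mu q,
    (forall s, ~~ root (q s) (r s) /\ T l j = q s * ('X - (r s)%:P) ^+ mu s) /\
    ((forall s, (c < c * mu s + a * j + l + ks s)%N) /\
     (c * (size (T l j)).-1 + n * a * j + b * l + k * b < n ^ 2 * c)%N).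
  move=> Tlj; have /choice[mu muP] s := poly_factor (r s) Tlj.
  have /choice[q qP] := muP; exists mu, q; split=> //.
  have [h1 h2] := term_bounds Tlj qP; have [h3 h4] := poly_bounds Tlj qP.
  exact: (pure_gap_arith n_ge2 aE bE cE m_gt0 m_le k_bnd (ltn_ord j) (ltn_ord l)).
case: (unliftP ord0 i) => [s|] ->.
  rewrite RS uS.
  have [l [j [Tlj e _]]] := zero_gk_sum n_ge2 L_rels L_frac aE bE cE n_char mon_neq0
    (r_root s) (xr_neq0 s) (P_xr s) T_neq0.
  have [mu [q [qP [/(_ s) lt _]]]] := strict l j Tlj; have [nr pE] := qP s.
  move: e; rewrite (P_monomial s _ _ nr pE) -f_T ord_atM // P_Pi; move: lt; clear.
  move: (c * mu s + a * j + l)%N (ord_at _ _) => A v; lia.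
rewrite R0 u0.
have [l [j [Tlj e _]]] := pole_gk_sum n_ge2 L_rels L_frac aE bE cE Pinf_x T_neq0.
have [mu [q [_ [_ lt]]]] := strict l j Tlj.
have [_ vE] := Pinf_monomial j l Tlj.
move: e; rewrite vE -f_T ord_atM // Pinf_Pi; move: lt N_eq; clear.
move: (c * _ + _ + _)%N (n ^ 2 * c)%N (m * c)%N (k * b)%N (ord_at _ _) => A B C D v; lia.
Qed.

End Function.

Lemma RR_finite_dim : exists d, has_dim iota (RR_space G) d.
Proof.
pose bas (t : 'I_a * 'I_n.+1 * 'I_(n ^ 2).+1) :=
  x ^+ t.2 * y ^+ t.1.2 * z ^+ t.1.1 / Pi.
apply: (@has_dim_sub_finite F L iota (RR_space G) _ bas).
  by move=> d e e'; apply: RR_space_linear.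
move=> f [->|[f0 fG]].
  by exists (fun=> 0); rewrite big1 // => t _; rewrite rmorph0 mul0r.
have [T fT] := gk_ring_sum n_ge2 L_rels aE bE cE (RR_mul_poles f0 fG).
exists (fun t : 'I_a * 'I_n.+1 * 'I_(n ^ 2).+1 => (T t.1.1 t.1.2)`_t.2).
apply: (mulIf Pi_neq0); rewrite fT mulr_suml.
transitivity (\sum_(l < a) \sum_(j < n.+1) \sum_(i < (n ^ 2).+1)
    iota (T l j)`_i * bas (l, j, i) * Pi); last by rewrite pair_big pair_big.
apply: eq_bigr => l _; apply: eq_bigr => j _; rewrite /monomial.
have sT : (size (T l j) <= (n ^ 2).+1)%N.
  by have [->|Tlj] := eqVneq (T l j) 0; [rewrite size_poly0|apply: (RR_degree f0 fG fT)].
rewrite (horner_coef_wide _ (n := (n ^ 2).+1)) ?size_map_poly // !mulr_suml.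
by apply: eq_bigr => i _; rewrite coef_map /bas /= -[RHS]mulrA divfK // !mulrA.
Qed.

Theorem gk_pure_gap : pure_gap R u.
Proof.
apply: pure_gap_of_strict => //; [by exists ord0; rewrite u0|exact: RR_finite_dim|].
move=> f f0 fG; have [T fT] := gk_ring_sum n_ge2 L_rels aE bE cE (RR_mul_poles f0 fG).
exact: RR_strict fT.
Qed.

End Main.

(** * From projective points and the equations of the curve to orders, relations and fractions *)

Section FunctionFieldFacts.

Variables (n : nat) (F L : fieldType) (iota : {rmorphism F -> L}) (x y z : L).
Implicit Types v : place iota.

Lemma row4E (T : Type) (t0 t1 t2 t3 : T) i :
  row4 t0 t1 t2 t3 0 i = tnth [tuple t0; t1; t2; t3] i.
Proof. by rewrite mxE. Qed.

Lemma pole_at_infty v :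
  centered_at (GK_coords x y z) (GK_point_infty F) v -> v x < 0.
Proof.
case=> j []; rewrite !row4E.
case: j => [[|[|[|[|//]]]]] hj; rewrite !(tnth_nth 0) /= ?eqxx // => _ x0.
move/(_ (Ordinal (isT : 3 < 4)%N)); rewrite !row4E !(tnth_nth 0) /=.
rewrite mul0r rmorph0 subr0 mul1r => -[/eqP|]; first by rewrite invr_eq0 (negPf x0).
by rewrite ordV oppr_gt0.
Qed.

Lemma pole_neq_const v r : v x < 0 -> x - iota r != 0.
Proof.
move=> vx; rewrite subr_eq0; apply: contraTneq vx => ->.
have [->|r0] := eqVneq r 0; first by rewrite rmorph0 ord_at0.
by rewrite ord_at_const.
Qed.

(** The center may be witnessed in the chart T or, when r is nonzero, in the chart X. In the latter
    d = 1/x - 1/r vanishes, which makes x a unit, and x - r = -d x r. *)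
Lemma zero_at_point v r : x - iota r != 0 ->
  centered_at (GK_coords x y z) (GK_point r) v -> 0 < v (x - iota r).
Proof.
move=> xr [j []]; rewrite !row4E.
case: j => [[|[|[|[|//]]]]] hj; rewrite !(tnth_nth 0) /= ?eqxx //.
  move=> r0 x0 /(_ (Ordinal (isT : 3 < 4)%N)).
  rewrite !row4E !(tnth_nth 0) /= !mul1r fmorphV; set d := _ - _.
  have xE : x - iota r = - (d * (x * iota r)).
    by rewrite /d mulrBl mulKf // mulrCA mulVf ?fmorph_eq0 // mulr1 opprB.
  have d0 : d != 0 by apply: contraNneq xr => d0; rewrite xE d0 mul0r oppr0.
  case=> [/eqP|vd]; first by rewrite (negPf d0).
  have vr s : s != 0 -> v (iota s) = 0 by apply: ord_at_const.
  have vx : v x = 0.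
    apply/eqP; rewrite -oppr_eq0 -ordV; apply/eqP.
    have [||_] := @ordD_lt _ _ _ v (iota r^-1) d.
    - by rewrite fmorph_eq0 invr_eq0.
    - by move=> _; rewrite vr ?invr_eq0.
    - by rewrite vr ?invr_eq0 // /d fmorphV subrKC.
  by rewrite xE ordN !ord_atM ?mulf_neq0 ?fmorph_eq0 // vx vr // !addr0.
move=> _ _ /(_ (Ordinal (isT : 0 < 4)%N)).
rewrite !row4E !(tnth_nth 0) /= !divr1 => -[e|//].
by rewrite e eqxx in xr.
Qed.

Hypothesis n_ge2 : (2 <= n)%N.
Hypothesis n_char : [pchar F].-nat n.
Hypothesis GK_L : GK_function_field n iota x y z.

(* With w = x^(n-1), summing the geometric series gives
   (1 + w) h(x) = w^(n+1) - 1 = (1 + w) (y^(n^2-1) - 1) in characteristic p. *)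
Lemma function_field_relations v : v x < 0 -> gk_relations n x y z.
Proof.
move=> vx; case: GK_L => ez ey _ _; split=> //; rewrite ez.
have n_gt0 : (0 < n)%N by apply: ltnW.
have chL : [pchar L].-nat n by rewrite (pnat_fmorph iota).
pose w := x ^+ (n - 1)%N.
have x0 : x != 0 by apply: contraTneq vx => ->; rewrite ord_at0.
have w1 : 1 + w != 0.
  have vw : v w < v 1 by rewrite ord_at1 /w ordX // pmulrn_llt0 // subn_gt0.
  have [||h _] := @ordD_lt _ _ _ v w 1; [by rewrite expf_neq0|by []|].
  by rewrite addrC.
have geo i : (\sum_(0 <= j < i) (-1) ^+ j.+1 * x ^+ (j * (n - 1))) * (1 + w) =
    (- w) ^+ i - 1.
  elim: i => [|i IH]; first by rewrite big_geq // mul0r expr0 subrr.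
  rewrite big_nat_recr //= mulrDl IH mulnC exprM -/w !exprS [(- w) ^+ i]exprNn.
  by ring.
(* Expanding (0 - 1)^n additively gives (-1)^n = -1 for odd and even characteristic alike. *)
have sgn : (- w) ^+ n.+1 = w ^+ n.+1.
  rewrite exprNn exprS.
  have := exprB_pchar 0 1 n_gt0 chL; rewrite sub0r expr0n gtn_eqF // expr1n sub0r => ->.
  by rewrite mulrN1 opprK mul1r.
apply: (mulIf w1); rewrite /GK_h -mulrA geo sgn.
have yn : y ^+ (n ^ 2)%N = y * (w * (1 + w) ^+ (n - 1)%N).
  have -> : (n ^ 2)%N = (n.+1 * (n - 1)).+1 by rewrite -mulnn; lia.
  rewrite exprS exprM -ey; congr (_ * _).
  have -> : x ^+ n + x = x * (1 + w) by rewrite mulrDr mulr1 -exprS subn1 prednK // addrC.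
  by rewrite exprMn.
rewrite yn mulrBl -!mulrA -exprSr subn1 prednK // exprDn_pchar // expr1n.
by rewrite exprS; ring.
Qed.

(** The fractions of elements of A form a subfield containing the constants, x, y and z, hence all
    of L by [GK_gen]. *)
Lemma function_field_frac v : v x < 0 -> forall f, exists g h,
  [/\ gk_ring n iota x y z g, gk_ring n iota x y z h, h != 0 & f = g / h].
Proof.
move=> vx f; have rels := function_field_relations vx.
have sA := gk_ring_subring n_ge2 iota rels.
have [A0 A1 AD AM] := sA.
have AN g : gk_ring n iota x y z g -> gk_ring n iota x y z (- g) by apply: gk_ringN.
pose S := [pred f : L | `[< exists g h,
  [/\ gk_ring n iota x y z g, gk_ring n iota x y z h, h != 0 & f = g / h] >]].
have S_A g : gk_ring n iota x y z g -> g \in S.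
  by move=> Ag; apply/asboolP; exists g, 1; rewrite oner_neq0 divr1.
suff /asboolP : f \in S by [].
case: GK_L => _ _ _; apply.
- split; first exact: S_A.
  + move=> _ _ /asboolP[g1 [h1 [Ag1 Ah1 h10 ->]]] /asboolP[g2 [h2 [Ag2 Ah2 h20 ->]]].
    apply/asboolP; exists (g1 * h2 - g2 * h1), (h1 * h2).
    split; [by apply: AD; [|apply: AN]; apply: AM|exact: AM|by rewrite mulf_neq0|].
    by rewrite -mulNr addf_div // mulNr.
  + move=> _ _ /asboolP[g1 [h1 [Ag1 Ah1 h10 ->]]] /asboolP[g2 [h2 [Ag2 Ah2 h20 ->]]].
    apply/asboolP; have [->|g20] := eqVneq g2 0.
      by exists 0, 1; rewrite mul0r invr0 mulr0 mul0r oner_neq0.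
    exists (g1 * h2), (h1 * g2).
    by split; [exact: AM|exact: AM|rewrite mulf_neq0|rewrite invf_div mulf_div].
- by move=> e; apply/S_A/gk_ring_const.
- exact/S_A/gk_ring_X.
- exact/S_A/gk_ring_Y.
- exact/S_A/gk_ring_Z.
Qed.

End FunctionFieldFacts.

Theorem corollary4p3
  (n : nat) (n_ge2 : (2 <= n)%N)
  (n_pp : exists p e : nat, prime p /\ n = (p ^ e)%N)
  (F : finFieldType) (card_F : #|F| = (n ^ 6)%N)
  (L : fieldType) (iota : {rmorphism F -> L})
  (x y z : L) (GK_L : GK_function_field n iota x y z)
  (a_ : 'I_n -> F) (a_inj : injective a_)
  (a_root : forall j : 'I_n, a_ j ^+ n + a_ j = 0)
  (Pinf : place iota)
  (Pinf_at : centered_at (GK_coords x y z) (GK_point_infty F) Pinf)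
  (P : 'I_n -> place iota)
  (P_at : forall j : 'I_n,
     centered_at (GK_coords x y z) (GK_point (a_ j)) (P j))
  (m : nat) (m_ge1 : (1 <= m)%N) (m_len : (m <= n)%N)
  (k : nat) :
  let a := (n ^ 2 - n + 1)%N in
  let b := (n ^ 3)%N in
  let c := (n ^ 3 + 1)%N in
  (2 <= k <= a)%N ->
  (0 < (n ^ 2 - m) * c - k * b)%N ->
  pure_gap
    (fun i : 'I_m.+1 =>
       if unlift ord0 i is Some j then P (widen_ord m_len j) else Pinf)
    (fun i : 'I_m.+1 =>
       if i == ord0 then ((n ^ 2 - m) * c - k * b)%N
       else if (i < m)%N then k
       else k.-1).
Proof.
move=> a b c k_bnd N_gt0.
have n_char : [pchar F].-nat n.
  case: n_pp => p [e [p_prime nE]].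
  have pF : p \in [pchar F].
    by apply: (@card_finPcharP F p (e * 6)) => //; rewrite card_F nE expnM.
  by rewrite nE pnatX pnatE // pF.
have F_char : [pchar F].-nat #|F| by rewrite card_F pnatX n_char.
have Pinf_x := pole_at_infty Pinf_at.
have rels := function_field_relations n_ge2 n_char GK_L Pinf_x.
have frac := function_field_frac n_ge2 n_char GK_L Pinf_x.
pose w := widen_ord m_len.
have r_inj : injective (a_ \o w).
  by move=> s t /a_inj /(congr1 val) /= e; apply: val_inj.
have xr s : x - iota (a_ (w s)) != 0 := pole_neq_const _ Pinf_x.
have Pxr s : 0 < P (w s) (x - iota (a_ (w s))) := zero_at_point (xr s) (P_at (w s)).
have n_le_n2 : (n <= n ^ 2)%N by rewrite leq_pmulr // ltnW.
have aE : (a + n = n ^ 2 + 1)%N by rewrite /a; clear -n_le_n2; lia.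
(* Both truncated subtractions are exact, as m <= n <= n^2 and the entry at Pinf is positive. *)
have N_eq : ((n ^ 2 - m) * c - k * b + m * c + k * b = n ^ 2 * c)%N.
  have : (m * c <= n ^ 2 * c)%N by rewrite leq_mul2r (leq_trans m_len) ?orbT.
  move: N_gt0; rewrite mulnBl; clear; lia.
have [k_ge2 k_le] := andP k_bnd.
(* The affine point with index [s], counted from 0, sits at position s + 1 of the tuple, so the
   smaller entry belongs to s + 1 = m. *)
pose ks (s : 'I_m) := if (s.+1 < m)%N then k else k.-1.
have ks_le s : (ks s <= k)%N by rewrite /ks; case: ifP => // _; apply: leq_pred.
have ks_gt0 s : (1 <= ks s)%N by rewrite /ks; case: ifP => _; clear -k_ge2; lia.
have ks_last (s : 'I_m) : s.+1 = m -> (ks s < k)%N.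
  by move=> sm; rewrite /ks sm ltnn; clear -k_ge2; lia.
have := gk_pure_gap n_ge2 n_char F_char rels frac aE (erefl b) (erefl c) Pinf_x m_ge1
  m_len r_inj (fun s => a_root (w s)) xr Pxr k_bnd ks_le ks_gt0 ks_last N_gt0 N_eq.
congr pure_gap; apply: funext => i; case: (unliftP ord0 i) => [s|] -> //=.
Qed.
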